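(* Let $E\subset\mathbb{R}^N$ be open, $T>0$, $E_T=E\times(0,T]$, and let $u$ be a non-negative, locally bounded, local, weak solution of $u_t-\Delta\ln u=0$ in $E_T$. Assume that $D\ln u\in L^p_{\rm loc}(E_T)$ for some $p>\frac{N+2}{2}$. Let $$S_o=\left\{(y,s)\in E_T:\ \limsup_{\rho\to0}\frac{1}{\rho^{N+2-p}}\iint_{(y,s)+Q_\rho}|D\ln u|^p\,dx\,dt>0\right\}.$$ Then $$P_{N+2-p}(S_o)=0\quad\text{if }N>1\ (\text{and } p\le N+2),\qquad\text{and}\qquad P_1(S_o)=0\quad\text{if }N=1.$$
   Context: $D$ denotes the spatial gradient. A non-negative function $u$ with $u\in C_{\rm loc}(0,T;L^2_{\rm loc}(E))$ and $\ln u\in L^2_{\rm loc}(0,T;W^{1,2}_{\rm loc}(E))$ is a local, weak sub-solution (super-solution) of $u_t-\Delta\ln u=0$ in $E_T$ if for every compact set $K\subset E$ and every sub-interval $[t_1,t_2]\subset(0,T]$ $$\int_K u\varphi\,dx\Big|_{t_1}^{t_2}+\int_{t_1}^{t_2}\int_K\Big(-u\varphi_t+\frac{Du}{u}\cdot D\varphi\Big)dx\,dt\le(\ge)\,0$$ for all non-negative $\varphi\in W^{1,2}_{\rm loc}(0,T;L^2(K))\cap L^2_{\rm loc}(0,T;W^{1,2}_o(K))$. A local, weak solution is a function that is both a local, weak sub-solution and a local, weak super-solution. (When $N=1$ the integrability condition on $D\ln u$ is already contained, with $p=2$, in the notion of solution.) For $\rho>0$, $K_\rho(y)$ is the cube in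 $\mathbb{R}^N$ centered at $y$ with side length $\rho$, and $(y,s)+Q_\rho=K_\rho(y)\times(s-\rho^2,s]$. Parabolic Hausdorff measure: for $U\subset\mathbb{R}^N\times\mathbb{R}$ and $k\ge0$, $P_k(U)=\lim_{\delta\to0}P_k^\delta(U)$, where $$P_k^\delta(U)=\inf\left\{\sum_{i=1}^\infty r_i^k:\ U\subset\bigcup_i[(y_i,t_i)+Q_{r_i}],\ r_i<\delta\right\}.$$ *)

(* Defs.v *)
From HB Require Import structures.
From mathcomp Require Import all_boot all_order all_algebra.
From mathcomp Require Import all_classical all_reals all_analysis.
From mathcomp Require Import measurable_realfun.

Set Implicit Arguments.
Unset Strict Implicit.
Unset Printing Implicit Defensive.

Import Order.TTheory GRing.Theory Num.Theory.
Import numFieldNormedType.Exports.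

Local Open Scope classical_set_scope.
Local Open Scope ring_scope.

(* R^N is 'rV[R]_N, with the product sigma-algebra, and a point (x,t) of
   space-time is an element of 'rV[R]_N * R. *)

Section measurable_rV.
Context {d : measure_display} {T : measurableType d} (n : nat).

Let coors : 'I_n -> 'rV[T]_n -> T := fun i x => x ord0 i.

Let rV_set0 : g_sigma_preimage coors set0.
Proof. exact: sigma_algebra0. Qed.

Let rV_setC A : g_sigma_preimage coors A -> g_sigma_preimage coors (~` A).
Proof. exact: sigma_algebraC. Qed.

Let rV_bigcup (F : _^nat) : (forall i, g_sigma_preimage coors (F i)) ->
  g_sigma_preimage coors (\bigcup_i (F i)).
Proof. exact: sigma_algebra_bigcup. Qed.

HB.instance Definition _ := @isMeasurable.Build (measure_tuple_display d)
  'rV[T]_n (g_sigma_preimage coors) rV_set0 rV_setC rV_bigcup.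

Lemma measurable_coord (i : 'I_n) :
  measurable_fun [set: 'rV[T]_n] (fun x : 'rV[T]_n => x ord0 i).
Proof.
move=> _ Y mY; rewrite setTI; apply: sub_sigma_algebra => /=.
rewrite -bigcup_seq/=; exists i => /=; first by rewrite mem_index_enum.
by exists Y => //; rewrite setTI.
Qed.

Lemma measurable_fun_rV d' (S : measurableType d') (f : S -> 'rV[T]_n) :
  (forall i, measurable_fun setT (fun x => f x ord0 i)) -> measurable_fun setT f.
Proof.
move=> mf; apply: (@measurability _ _ _ _ _ _ (\big[setU/set0]_(i < n)
  preimage_set_system setT (coors i) measurable)) => //.
move=> _ [B + <-]; rewrite setTI.
elim/big_ind : _ => [//|A1 A2 h1 h2 [/h1//|/h2//]|i _ [C mC <-]].
rewrite setTI; have := mf i measurableT C mC.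
by rewrite setTI.
Qed.

End measurable_rV.

Section lebesgue_rV.
Context {R : realType}.

Definition rV_rcons n (z : 'rV[R]_n * R) : 'rV[R]_n.+1 :=
  \row_(i < n.+1) (if unlift ord_max i is Some j then z.1 ord0 j else z.2).

Lemma measurable_rV_rcons n : measurable_fun setT (@rV_rcons n).
Proof.
apply: measurable_fun_rV => i; rewrite /rV_rcons.
under eq_fun do rewrite mxE.
case: (unlift ord_max i) => [j|]; last exact: measurable_snd.
exact: (measurableT_comp (measurable_coord j) measurable_fst).
Qed.

Section measure_rcons.
Context (n : nat) (mu : {measure set 'rV[R]_n -> \bar R}).

Definition measure_rcons : set 'rV[R]_n.+1 -> \bar R :=
  pushforward (mu \x lebesgue_measure)%E (@rV_rcons n).

Let preimage_rcons (A : set 'rV[R]_n.+1) : measurable A ->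
  measurable (@rV_rcons n @^-1` A).
Proof. by move=> mA; rewrite -[X in measurable X]setTI; exact: measurable_rV_rcons. Qed.

Let measure_rcons0 : measure_rcons set0 = 0%E.
Proof. by rewrite /measure_rcons /pushforward preimage_set0 measure0. Qed.

Let measure_rcons_ge0 A : (0 <= measure_rcons A)%E.
Proof. by rewrite /measure_rcons /pushforward; exact: measure_ge0. Qed.

Let measure_rcons_sigma_additive : semi_sigma_additive measure_rcons.
Proof.
move=> F mF tF mUF; rewrite /measure_rcons /pushforward preimage_bigcup.
apply: measure_semi_sigma_additive.
- by move=> i; exact: preimage_rcons.
- apply/trivIsetP => /= i j _ _ ij; rewrite -preimage_setI.
  by move/trivIsetP : tF => /(_ _ _ _ _ ij) ->//; rewrite preimage_set0.
- by rewrite -preimage_bigcup; exact: preimage_rcons.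
Qed.

HB.instance Definition _ := isMeasure.Build _ _ _ measure_rcons
  measure_rcons0 measure_rcons_ge0 measure_rcons_sigma_additive.

End measure_rcons.

(* Lebesgue measure on R^N (on its Borel sets) as the N-fold product of the
   Lebesgue measure of R; see [lebesgue_rV_box]. *)
Fixpoint lebesgue_rV (n : nat) : {measure set 'rV[R]_n -> \bar R} :=
  if n is m.+1 then measure_rcons (lebesgue_rV m) else \d_ (0 : 'rV[R]_0).

Lemma measurable_box n (A : 'I_n -> set R) : (forall i, measurable (A i)) ->
  measurable [set x : 'rV[R]_n | forall i, A i (x ord0 i)].
Proof.
move=> mA; rewrite [X in measurable X](_ : _ =
  \bigcap_(i in [set: 'I_n]) ((fun x : 'rV[R]_n => x ord0 i) @^-1` A i)).
  apply: fin_bigcap_measurable => // i _.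
  by rewrite -[X in measurable X]setTI; exact: measurable_coord.
by apply/seteqP; split => x /= Ax i; [move=> _|]; apply: Ax.
Qed.

Lemma lebesgue_rV_box n (A : 'I_n -> set R) : (forall i, measurable (A i)) ->
  lebesgue_rV n [set x | forall i, A i (x ord0 i)] =
  (\prod_(i < n) lebesgue_measure (A i))%E.
Proof.
elim: n A => [|n IH] A mA.
  by rewrite big_ord0 /= diracE mem_set// => -[].
rewrite big_ord_recr/= -IH//.
have mB := @measurable_box n _ (fun i => mA (widen_ord (leqnSn n) i)).
apply: etrans (product_measure1E (lebesgue_rV n) lebesgue_measure mB (mA ord_max)).
rewrite /measure_rcons /pushforward; congr (_ _).
apply/seteqP; split => -[x t] /=; rewrite /rV_rcons.
  move=> h; split => [i|].
    have := h (lift ord_max i); rewrite mxE liftK.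
    by congr (A _ _); apply/val_inj; rewrite /= /bump leqNgt ltn_ord.
  by have := h ord_max; rewrite mxE unlift_none.
move=> [h1 h2] i; rewrite mxE; case: unliftP => [j ->|->//].
suff -> : lift ord_max j = widen_ord (leqnSn n) j by exact: h1.
by apply/val_inj; rewrite /= /bump leqNgt ltn_ord.
Qed.

Definition lebesgue_rVR (N : nat) :
    {measure set ('rV[R]_N * measurableTypeR R) -> \bar R} :=
  (lebesgue_rV N \x lebesgue_measure)%E.

End lebesgue_rV.

Section function_spaces.
Context {R : realType}.

Definition Lp_on d (X : measurableType d) (mu : set X -> \bar R) (D : set X)
    (q : R) (f : X -> \bar R) : Prop :=
  measurable_fun D f /\ (\int[mu]_(x in D) (`|f x| `^ q) < +oo)%E.

Context {N : nat}.
Implicit Types (E K : set 'rV[R]_N) (T : R).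

Definition unit_rV (i : 'I_N) : 'rV[R]_N := delta_mx ord0 i.

Definition partial (i : 'I_N) (f : 'rV[R]_N -> R) : 'rV[R]_N -> R :=
  'D_(unit_rV i) f.

Definition euclid_norm (v : 'rV[R]_N) : R :=
  Num.sqrt (\sum_(i < N) v ord0 i ^+ 2).

Definition smooth_rV (f : 'rV[R]_N -> R) : Prop :=
  forall s : seq 'I_N, let g := foldr partial f s in
    continuous g /\ forall x i, derivable g x (unit_rV i).

Definition Cc_infty (Omega : set 'rV[R]_N) (f : 'rV[R]_N -> R) : Prop :=
  smooth_rV f /\
  exists C, [/\ compact C, C `<=` Omega & forall x, ~ C x -> f x = 0].

Definition Cc_infty_time T (f : R -> R) : Prop :=
  (forall n t, derivable (derive1n n f) t 1) /\
  exists a b, [/\ 0 < a, b < T & forall t, ~~ (a <= t <= b) -> f t = 0].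

Definition weak_gradient E (v : 'rV[R]_N -> \bar R) (g : 'rV[R]_N -> 'rV[R]_N)
    : Prop :=
  forall eta, Cc_infty E eta -> forall i : 'I_N,
    (\int[lebesgue_rV N]_(x in E) (v x * (partial i eta x)%:E) =
     - \int[lebesgue_rV N]_(x in E) (g x ord0 i * eta x)%:E)%E.

(* Locality in time is with respect to (0,T]: integrability holds on
   K x [t1,t2] for all compact K in E and [t1,t2] in (0,T]. *)
Definition Lp_loc_cyl E T (q : R) (f : 'rV[R]_N * R -> \bar R) : Prop :=
  forall K t1 t2, compact K -> K `<=` E -> 0 < t1 -> t2 <= T ->
    Lp_on (@lebesgue_rVR R N) (K `*` `[t1, t2]) q f.

Definition spatial_gradient E T (v : 'rV[R]_N * R -> \bar R)
    (g : 'rV[R]_N * R -> 'rV[R]_N) : Prop :=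
  [/\ Lp_loc_cyl E T 1 v,
      forall i, Lp_loc_cyl E T 1 (fun z => (g z ord0 i)%:E) &
      {ae lebesgue_measure, forall t : R, 0 < t < T ->
         weak_gradient E (fun x => v (x, t)) (fun x => g (x, t))}].

Definition L2loc_W12loc E T (v : 'rV[R]_N * R -> \bar R) : Prop :=
  exists g, [/\ spatial_gradient E T v g, Lp_loc_cyl E T 2 v &
    forall i, Lp_loc_cyl E T 2 (fun z => (g z ord0 i)%:E)].

(* Continuity of t |-> f(.,t) from (0,T] to L^2(K); [f] is the representative
   that is defined for every time. *)
Definition Cloc_L2 K T (f : 'rV[R]_N * R -> R) : Prop :=
  forall t, 0 < t <= T ->
    Lp_on (lebesgue_rV N) K 2 (fun x => (f (x, t))%:E) /\
    (\int[lebesgue_rV N]_(x in K) ((f (x, s) - f (x, t)) ^+ 2)%:E)%E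
      @[s --> within `]0, T] (nbhs t)] --> 0%E.

(* W^{1,2}_o(K): closure of the smooth functions with compact support in the
   interior of K, [w] being the gradient of [v]. *)
Definition W12o K (v : 'rV[R]_N -> R) (w : 'rV[R]_N -> 'rV[R]_N) : Prop :=
  [/\ Lp_on (lebesgue_rV N) K 2 (fun x => (v x)%:E),
      forall i, Lp_on (lebesgue_rV N) K 2 (fun x => (w x ord0 i)%:E) &
      exists eta : nat -> 'rV[R]_N -> R,
        [/\ forall n, Cc_infty K° (eta n),
            (\int[lebesgue_rV N]_(x in K) ((eta n x - v x) ^+ 2)%:E)%E
              @[n --> \oo] --> 0%E &
            forall i, (\int[lebesgue_rV N]_(x in K)
               ((partial i (eta n) x - w x ord0 i) ^+ 2)%:E)%E
              @[n --> \oo] --> 0%E]].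

(* phi in W^{1,2}_loc(0,T;L^2(K)), with weak time derivative [dphi], taken in
   its representative that is continuous in time with values in L^2(K). *)
Definition W12loc_L2 K T (phi dphi : 'rV[R]_N * R -> R) : Prop :=
  [/\ forall t1 t2, 0 < t1 -> t2 <= T ->
        Lp_on (@lebesgue_rVR R N) (K `*` `[t1, t2]) 2 (EFin \o phi) /\
        Lp_on (@lebesgue_rVR R N) (K `*` `[t1, t2]) 2 (EFin \o dphi),
      Cloc_L2 K T phi &
      forall eta, Cc_infty_time T eta ->
        {ae lebesgue_rV N, forall x, K x ->
          (\int[lebesgue_measure]_(t in `]0%R, T[) (phi (x, t) * derive1 eta t)%:E =
           - \int[lebesgue_measure]_(t in `]0%R, T[) (dphi (x, t) * eta t)%:E)%E}].

Definition L2loc_W12o K T (phi : 'rV[R]_N * R -> R)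
    (Dphi : 'rV[R]_N * R -> 'rV[R]_N) : Prop :=
  [/\ forall t1 t2, 0 < t1 -> t2 <= T ->
        Lp_on (@lebesgue_rVR R N) (K `*` `[t1, t2]) 2 (EFin \o phi) /\
        forall i, Lp_on (@lebesgue_rVR R N) (K `*` `[t1, t2]) 2
                    (fun z => (Dphi z ord0 i)%:E) &
      {ae lebesgue_measure, forall t : R, 0 < t < T ->
         W12o K (fun x => phi (x, t)) (fun x => Dphi (x, t))}].

End function_spaces.

Section log_diffusion.
Context {R : realType} {N : nat}.
Implicit Types (E K : set 'rV[R]_N) (T : R) (u : 'rV[R]_N * R -> R).

(* ln u, with ln 0 = -oo; its local integrability forces u > 0 a.e. *)
Definition log_fun u : 'rV[R]_N * R -> \bar R := fun z => lne (u z)%:E.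

Definition solution_class E T u : Prop :=
  [/\ forall z, (E `*` `]0, T]) z -> 0 <= u z,
      measurable_fun (E `*` `]0, T]) u,
      forall K, compact K -> K `<=` E -> Cloc_L2 K T u &
      L2loc_W12loc E T (log_fun u)].

Definition weak_form u (Du : 'rV[R]_N * R -> 'rV[R]_N) K (t1 t2 : R)
    (phi dphi : 'rV[R]_N * R -> R) (Dphi : 'rV[R]_N * R -> 'rV[R]_N) : \bar R :=
  (\int[lebesgue_rV N]_(x in K) (u (x, t2) * phi (x, t2))%:E
   - \int[lebesgue_rV N]_(x in K) (u (x, t1) * phi (x, t1))%:E
   + \int[lebesgue_measure]_(t in `[t1, t2]) \int[lebesgue_rV N]_(x in K)
       (- u (x, t) * dphi (x, t)
        + \sum_(i < N) Du (x, t) ord0 i / u (x, t) * Dphi (x, t) ord0 i)%:E)%E.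

Definition weak_ineq (sgn : \bar R -> Prop) E T u : Prop :=
  solution_class E T u /\
  exists2 Du, spatial_gradient E T (EFin \o u) Du &
    forall K t1 t2, compact K -> K `<=` E -> 0 < t1 -> t1 <= t2 -> t2 <= T ->
    forall phi dphi Dphi,
      (forall x t, K x -> 0 < t <= T -> 0 <= phi (x, t)) ->
      W12loc_L2 K T phi dphi -> L2loc_W12o K T phi Dphi ->
      sgn (weak_form u Du K t1 t2 phi dphi Dphi).

Definition weak_subsolution E T u : Prop :=
  weak_ineq (fun a => (a <= 0)%E) E T u.

Definition weak_supersolution E T u : Prop :=
  weak_ineq (fun a => (0 <= a)%E) E T u.

Definition weak_solution E T u : Prop :=
  weak_subsolution E T u /\ weak_supersolution E T u.

Definition locally_bounded E T u : Prop :=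
  forall C, compact C -> C `<=` E `*` `]0, T] ->
    exists M : R, {ae @lebesgue_rVR R N, forall z, C z -> `|u z| <= M}.

(* |g| in L^p_loc(E_T), locality being with respect to the compact subsets of
   E_T = E x (0,T]. *)
Definition Lp_loc E T (p : R) (g : 'rV[R]_N * R -> 'rV[R]_N) : Prop :=
  forall C, compact C -> C `<=` E `*` `]0, T] ->
    Lp_on (@lebesgue_rVR R N) C p (fun z => (euclid_norm (g z))%:E).

Definition cube (y : 'rV[R]_N) (rho : R) : set 'rV[R]_N :=
  [set x | forall i, `|x ord0 i - y ord0 i| < rho / 2].

Definition pcylinder (z : 'rV[R]_N * R) (rho : R) : set ('rV[R]_N * R) :=
  cube z.1 rho `*` `]z.2 - rho ^+ 2, z.2].

Definition singular_set E T (p : R) (g : 'rV[R]_N * R -> 'rV[R]_N)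
    : set ('rV[R]_N * R) :=
  [set z | (E `*` `]0, T]) z /\
    (0 < limf_esup (fun rho : R =>
       (1 / rho `^ (N%:R + 2 - p))%:E *
       \int[@lebesgue_rVR R N]_(w in pcylinder z rho)
         (euclid_norm (g w) `^ p)%:E) (0 : R)^'+)%E].

(* The coverings are countable, i.e. finite (possibly empty) or infinite
   sequences of cylinders: for k = 0 an infinite sequence of radii has an
   infinite sum, and even P_0 of the empty set would be +oo. *)
Definition parabolic_premeasure (k delta : R) (U : set ('rV[R]_N * R))
    : \bar R :=
  ereal_inf [set a | exists (I : set nat) (z : nat -> 'rV[R]_N * R)
      (r : nat -> R),
    [/\ forall i, I i -> 0 < r i < delta,
        U `<=` \bigcup_(i in I) pcylinder (z i) (r i) &
        a = (\esum_(i in I) (r i `^ k)%:E)%E]].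

Definition parabolic_hausdorff (k : R) (U : set ('rV[R]_N * R)) : \bar R :=
  lim (parabolic_premeasure k delta U @[delta --> (0 : R)^'+]).

End log_diffusion.

(* Main.v *)
Require Import Defs.
From HB Require Import structures.
From mathcomp Require Import all_boot all_order all_algebra.
From mathcomp Require Import all_classical all_reals all_analysis.
From mathcomp Require Import measurable_realfun.
From mathcomp Require Import ring lra.

Set Implicit Arguments.
Unset Strict Implicit.
Unset Printing Implicit Defensive.

Import Order.TTheory GRing.Theory Num.Theory.
Import numFieldNormedType.Exports.

Local Open Scope classical_set_scope.
Local Open Scope ring_scope.

(** A singular point is a point at which [f = |D ln u|^p] has positive upper
    density with respect to [r^k], where [k = N + 2 - p < N + 2].  For every
    locally integrable [f >= 0] and every [k < N + 2] the set of such points is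
    [P_k]-null ([parabolic_premeasure_density_eq0]).  Indeed, each of them is
    the vertex of arbitrarily small cylinders [Q] of size [r] with
    [eps r^k <= int_Q f].  A Vitali selection ([vitali_selection]) extracts
    disjoint cylinders, of sizes at most [d], whose enlargements cover the set
    ([pcylinder_engulf]), and [sum r^k <= eps^-1 int f] over their union.  The
    Lebesgue measure of this union is
    [sum r^(N+2) <= d^(N+2-k) sum r^k], which tends to [0] with [d]; by
    absolute continuity of the integral, so does [sum r^k]
    ([packing_sum_small]).

    For [N > 1] the theorem is this result for [f = |D ln u|^p].  For [N = 1]
    the exponent is [1] while the densities are taken with [r^(3-p)].  If
    [p >= 2], then [r <= r^(3-p)] for [r <= 1], and a point that is singular for
    [r^(3-p)] is singular for [r] ([upper_density_le_exponent]).  If [p < 2], a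
    comparison of Hoelder type turns positive density of [|D ln u|^p] with
    respect to [r^(3-p)] into positive density of [|D ln u|^2] with respect to
    [r] ([upper_density_exponent]), and it remains to see that [D ln u] is
    locally square integrable.  The definition of a solution provides some
    square integrable weak gradient of [ln u]; the given one agrees with it
    almost everywhere.  This is the uniqueness of weak gradients: on almost
    every time slice, testing with smooth cutoffs that increase to the
    indicator of a box shows that both gradients have the same integrals over
    boxes, hence are equal almost everywhere
    ([weak_gradient_unique]), and Tonelli's theorem concludes
    ([integral_eq_spatial_gradient]). *)

(** * Vitali selection and parabolic cylinders *)

(** Zorn's lemma is applied to the disjoint subfamilies [G] that serve every
    member of [D] they meet: some member of [G] of at least half its size meets
    it.  If a maximal [G] missed some member of [D] entirely, a missed member of
    nearly maximal size could be added to [G]. *)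
Lemma vitali_selection (R : realType) (X I : Type) (Q : I -> set X)
    (r : I -> R) (M : R) (D : set I) :
  (forall i, D i -> Q i !=set0) -> (forall i, D i -> 0 < r i <= M) ->
  exists G, [/\ G `<=` D, trivIset G Q &
    forall i, D i -> exists2 j, G j & Q i `&` Q j !=set0 /\ r i <= 2 * r j].
Proof.
move=> Q0 rM.
pose meets (G : set I) i := exists2 j, G j & Q i `&` Q j !=set0.
pose P (G : set I) := [/\ G `<=` D, trivIset G Q & forall i, D i -> meets G i ->
  exists2 j, G j & Q i `&` Q j !=set0 /\ r i <= 2 * r j].
have [|G [[GD tG dG] maxG]] := @Zorn_bigcup I P.
  move=> F FP totF; split.
  - by apply: bigcup_sub => A /FP[].
  - move=> i j [A FA Ai] [B FB Bj]; have [AB|BA] := totF _ _ FA FB.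
      by have [_ t _] := FP _ FB; apply: t => //; exact: AB.
    by have [_ t _] := FP _ FA; apply: t => //; exact: BA.
  - move=> i Di [j [A FA Aj] ij]; have [_ _ h] := FP _ FA.
    have [|k Ak ik] := h i Di; first by exists j.
    by exists k => //; exists A.
exists G; split => // i Di; apply: (dG) => //; apply: contrapT => nmi.
pose B := r @` [set i | D i /\ ~ meets G i].
have supB : has_sup B.
  split; first by exists (r i), i.
  by exists M => _ [j [/rM/andP[_ ?] _] <-].
have Bi : B (r i) by exists i.
have supB0 : 0 < sup B.
  apply: (@lt_le_trans _ _ (r i)); first by have /andP[] := rM _ Di.
  exact: (ub_le_sup supB.2).
have [_ [i1 [Di1 ni1] <-] ri1] := sup_adherent (divr_gt0 supB0 (ltr0n _ 2)) supB.
have r2 j : D j -> ~ meets G j -> r j <= 2 * r i1.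
  move=> Dj nj; have : r j <= sup B by apply: (ub_le_sup supB.2); exists j.
  move: ri1; lra.


apply: (maxG (G `|` [set i1])).
  split; first by move=> x Gx; left.
  move=> /(_ i1 (or_intror erefl)) Gi1; apply: ni1; exists i1 => //.
  by have [x Qx] := Q0 _ Di1; exists x.
split.
- by move=> x [/GD//|->].
- move=> x y [Gx|->] [Gy|->]//; first exact: tG.
  + by rewrite setIC => xi1; case: ni1; exists x.
  + by move=> i1y; case: ni1; exists y.
- move=> x Dx mx; have [mG|nG'] := pselect (meets G x).
    by have [j Gj h] := dG _ Dx mG; exists j => //; left.
  case: mx => j [Gj|->] xj; first by exfalso; apply: nG'; exists j.
  by exists i1; [right|split => //; exact: r2].
Qed.

Section cylinders.
Context {R : realType} {N : nat}.
Implicit Types (z w : 'rV[R]_N * R) (r s : R).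

Local Notation leb := (@lebesgue_rVR R N).

Lemma cubeE (y : 'rV[R]_N) r :
  cube y r = [set x : 'rV[R]_N | forall i,
    `]y ord0 i - r / 2, (y ord0 i + r / 2)%R[%classic (x ord0 i)].
Proof.
apply/seteqP; split => x /= xy i; have := xy i;
  by rewrite in_itv/= ltr_distl.
Qed.

Lemma measurable_cube (y : 'rV[R]_N) r : measurable (cube y r).
Proof.
rewrite cubeE; apply: (@measurable_box _ _ (fun i : 'I_N =>
  `]y ord0 i - r / 2, (y ord0 i + r / 2)%R[%classic)) => i.
exact: measurable_itv.
Qed.

Lemma measurable_pcylinder z r :
  measurable (pcylinder z r : set ('rV[R]_N * measurableTypeR R)).
Proof. by apply: measurableX => //; exact: measurable_cube. Qed.

Lemma lebesgue_pcylinder z r : 0 < r ->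
  leb (pcylinder z r) = (r `^ (N%:R + 2))%:E.
Proof.
move=> r0; rewrite /lebesgue_rVR /pcylinder.
apply: etrans (product_measure1E (lebesgue_rV N) lebesgue_measure
  (measurable_cube z.1 r) (measurable_itv _)) _.
rewrite cubeE (@lebesgue_rV_box _ _ (fun i : 'I_N =>
  `]z.1 ord0 i - r / 2, (z.1 ord0 i + r / 2)%R[%classic)); last first.
  by move=> i; exact: measurable_itv.
rewrite (eq_bigr (fun=> r%:E)); last first.
  move=> i _; rewrite lebesgue_measure_itv/= lte_fin ltrD2l gtrN ?divr_gt0//.
  by rewrite -EFinB; congr EFin; lra.
have time_length : lebesgue_measure `]z.2 - r ^+ 2, z.2] = (r ^+ 2)%:E.
  by rewrite lebesgue_measure_itv/= lte_fin gtrBl exprn_gt0// -EFinB subKr.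
apply: etrans (congr1 (mule _) time_length) _.
rewrite prodEFin -EFinM; congr EFin.
rewrite prodr_const card_ord -!powR_mulrn ?(ltW r0)// -powRD//.
by rewrite (gt_eqF r0) implybT.
Qed.

Lemma mem_pcylinder z r : 0 < r -> pcylinder z r z.
Proof.
move=> r0; split => /= [i|]; first by rewrite subrr normr0 divr_gt0.
by rewrite in_itv/= lexx andbT gtrBl exprn_gt0.
Qed.

(** The cylinders extend backward in time from their vertex, so a cylinder that
    contains vertices later than the vertex of [w] must be shifted forward: [z]
    is at most [r ^+ 2 <= 4 * s ^+ 2] later than [w], and less than [s ^+ 2]
    earlier.  The duration [(3 * s) ^+ 2] covers both, and the side [3 * s]
    covers the spatial distance [(r + s) / 2]. *)
Lemma pcylinder_engulf z w r s : 0 < r -> 0 < s -> r <= 2 * s ->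
  pcylinder z r `&` pcylinder w s !=set0 ->
  pcylinder (w.1, w.2 + 4 * s ^+ 2) (3 * s) z.
Proof.
move=> r0 s0 rs [x [[/= xz1 xz2] [/= xw1 xw2]]]; split => /= [i|].
  have := ler_distD (x.1 ord0 i) (z.1 ord0 i) (w.1 ord0 i).
  have := xw1 i; have := xz1 i; rewrite [X in X < r / 2]distrC.
  move: rs; lra.
move: xz2 xw2; rewrite !in_itv/= => /andP[z1 z2] /andP[w1 w2].
have r2 : r ^+ 2 <= 4 * s ^+ 2 by nra.
by apply/andP; split; nra.
Qed.

(** Disjoint cylinders contain distinct points with rational coordinates. *)
Lemma trivIset_pcylinder_countable (I : Type) (z : I -> 'rV[R]_N * R)
    (r : I -> R) (D : set I) : (forall i, D i -> 0 < r i) ->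
  trivIset D (fun i => pcylinder (z i) (r i)) -> countable D.
Proof.
move=> r0 tD.
have [q qD] : {q : I -> 'rV[rat]_N * rat & forall i, D i ->
    pcylinder (z i) (r i) (map_mx ratr (q i).1, ratr (q i).2)}.
  apply: (@choice _ _ (fun i q => D i ->
    pcylinder (z i) (r i) (map_mx ratr q.1, ratr q.2))) => i.
  have [Di|nDi] := pselect (D i); last by exists (0, 0).
  have ri := r0 _ Di.
  have [f fP] : {f : 'I_N -> rat & forall j,
      `|ratr (f j) - (z i).1 ord0 j| < r i / 2}.
    apply: (@choice _ _ (fun j (q : rat) =>
      `|ratr q - (z i).1 ord0 j| < r i / 2)) => j.
    have /rat_in_itvoo[a] : (z i).1 ord0 j - r i / 2 < (z i).1 ord0 j + r i / 2.
      by lra.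
    by rewrite in_itv/= => a2; exists a; rewrite ltr_distl.
  have /rat_in_itvoo[b] : (z i).2 - r i ^+ 2 < (z i).2.
    by rewrite gtrBl exprn_gt0.
  rewrite in_itv/= => /andP[b1 b2].
  exists (\row_j f j, b) => _; split => [j|]/=; first by rewrite !mxE.
  by rewrite in_itv/= b1 ltW.
have inj_q : {in D &, injective q}.
  move=> i j /[!inE] Di Dj qij; apply: tD => //.
  exists (map_mx ratr (q i).1, ratr (q i).2); split; first exact: qD.
  by rewrite qij; exact: qD.
apply/countable_injP; exists (pickle \o q) => i j Di Dj /=.
by move=> /(pcan_inj pickleK) /inj_q; apply.
Qed.

End cylinders.

(** * Coverings by cylinders on which the integral is large *)

Section density_covering.
Context {R : realType}.

Lemma integral_abs_continuous d (X : measurableType d)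
    (mu : {measure set X -> \bar R}) (C : set X) (f : X -> R) :
  measurable C -> measurable_fun C f -> (forall x, 0 <= f x) ->
  (\int[mu]_(x in C) (f x)%:E < +oo)%E ->
  forall e : R, 0 < e -> exists2 d : R, 0 < d & forall A : set X,
    measurable A -> A `<=` C -> (mu A < d%:E)%E ->
    (\int[mu]_(x in A) (f x)%:E < e%:E)%E.
Proof.
move=> mC mf f0 foo e e0.
have intf : mu.-integrable C (EFin \o f).
  apply/integrableP; split; first exact/measurable_EFinP.
  by under eq_integral do rewrite gee0_abs ?lee_fin//.
have intg : mu.-integrable setT (EFin \o (f \_ C)).
  by rewrite -restrict_EFin; exact/(integrable_mkcond _ mC).
have [dl [dl0 dlP]] := integral_normr_continuous intg e0.
exists dl => // A mA AC muA; have := dlP A mA muA.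
have -> : (\int[mu]_(x in A) (f x)%:E =
           \int[mu]_(x in A) (`|(f \_ C) x|)%:E)%E.
  apply: eq_integral => x /[!inE] Ax.
  by rewrite patchE ifT ?inE ?ger0_norm//; apply: AC.
rewrite /Rintegral -lte_fin fineK// ge0_fin_numE; last first.
  by apply: integral_ge0 => x _; rewrite lee_fin.
have := integrableS measurableT mA (@subsetT _ A) intg.
by move=> /integrableP[_].
Qed.


Context {N : nat}.
Local Notation X := ('rV[R]_N * measurableTypeR R)%type.
Local Notation leb := (@lebesgue_rVR R N).

(** Disjoint cylinders on which the integral of [f] is at least [eps * r ^ k]
    have [\sum r ^ k <= M / eps], [M] being the integral of [f] over [C].  So
    their total Lebesgue measure [\sum r ^ (N + 2)] is at most
    [d0 ^ (N + 2 - k) * M / eps], and absolute continuity of the integral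
    improves the first bound to [e] once [d0] is small. *)
Lemma packing_sum_small (C : set X) (f : X -> R) (k eps : R) :
  measurable C -> measurable_fun C f -> (forall x, 0 <= f x) ->
  (\int[leb]_(x in C) (f x)%:E < +oo)%E ->
  k < N%:R + 2 -> 0 < eps -> forall e : R, 0 < e ->
  exists2 d0 : R, 0 < d0 & forall (s : seq X) (r : X -> R), uniq s ->
    trivIset [set` s] (fun z => pcylinder z (r z)) ->
    (forall z, z \in s -> [/\ 0 < r z <= d0, pcylinder z (r z) `<=` C &
      ((eps * r z `^ k)%:E <= \int[leb]_(x in pcylinder z (r z)) (f x)%:E)%E]) ->
    \sum_(z <- s) r z `^ k <= e.
Proof.
move=> mC mf f0 foo kN eps0 e e0.
have [d dgt0 dP] := integral_abs_continuous mC mf f0 foo (mulr_gt0 eps0 e0).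
set M := fine (\int[leb]_(x in C) (f x)%:E).
have M0 : 0 <= M by apply: fine_ge0; apply: integral_ge0 => x _; rewrite lee_fin.
have ME : (\int[leb]_(x in C) (f x)%:E = M%:E)%E.
  rewrite fineK// ge0_fin_numE//.
  by apply: integral_ge0 => x _; rewrite lee_fin.
set a := N%:R + 2 - k; have a0 : 0 < a by rewrite subr_gt0.
have M1 : 0 < M + 1 by lra.
set c := d * eps / (M + 1).
have c0 : 0 < c by rewrite divr_gt0// mulr_gt0.
(* d0 ^ a = c, chosen so that c * (M / eps) < d *)
exists (c `^ a^-1); first exact: powR_gt0.
move=> s r us ts sP.
set D := \big[setU/set0]_(z <- s) pcylinder z (r z).
have mD : measurable D by apply: bigsetU_measurable => z _; exact: measurable_pcylinder.
have DC : D `<=` C.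
  by rewrite /D -bigcup_seq => x [z /= /sP[_ + _]]; apply.
have intD : (\int[leb]_(x in D) (f x)%:E =
    \sum_(z <- s) \int[leb]_(x in pcylinder z (r z)) (f x)%:E)%E.
  apply: ge0_integral_bigsetU => //.
  - by move=> z; exact: measurable_pcylinder.
  - by apply/measurable_EFinP; apply: measurable_funS mf.
  - by move=> x _; rewrite lee_fin.
have sumD : ((eps * \sum_(z <- s) r z `^ k)%:E <= \int[leb]_(x in D) (f x)%:E)%E.
  rewrite intD mulr_sumr -sumEFin big_seq [leRHS]big_seq.
  by apply: lee_sum => z /sP[].
rewrite -(ler_pM2l eps0) -lee_fin; apply: (le_trans sumD); apply/ltW/dP => //.
have -> : leb D = (\sum_(z <- s) r z `^ (N%:R + 2))%:E.
  rewrite /D -bigcup_seq measure_fin_bigcup//; last first.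
    by move=> z _; exact: measurable_pcylinder.
  rewrite -fsbig_seq// -sumEFin big_seq [RHS]big_seq.
  by apply: eq_bigr => z /sP[/andP[r0 _] _ _]; exact: lebesgue_pcylinder.
rewrite lte_fin.
have sumM : \sum_(z <- s) r z `^ k <= M / eps.
  rewrite ler_pdivlMr// mulrC -lee_fin -ME; apply: (le_trans sumD).
  apply: ge0_subset_integral => //; first exact/measurable_EFinP.
  by move=> x _; rewrite lee_fin.
apply: (@le_lt_trans _ _ (c * (M / eps))); last first.
  have -> : c * (M / eps) = d * (M / (M + 1)).
    by rewrite /c; field; rewrite !gt_eqF.
  by rewrite gtr_pMr// ltr_pdivrMr// mul1r ltrDl.
apply: (@le_trans _ _ (c * \sum_(z <- s) r z `^ k)); last by rewrite ler_pM2l.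
rewrite mulr_sumr big_seq [leRHS]big_seq; apply: ler_sum => z /sP[/andP[r0 rd] _ _].
have -> : N%:R + 2 = a + k by rewrite /a subrK.
rewrite powRD; last by rewrite (gt_eqF r0) implybT.
rewrite ler_pM2r ?powR_gt0//.
have -> : c = (c `^ a^-1) `^ a by rewrite -powRrM mulVf ?gt_eqF// powRr1// ltW.
by apply: ge0_ler_powR; rewrite ?nnegrE ?powR_ge0// ltW.
Qed.


Lemma parabolic_premeasure_ge0 k d (U : set X) :
  (0 <= parabolic_premeasure k d U)%E.
Proof.
apply: le_ereal_inf_tmp => _ [I [z [r [_ _ ->]]]].
by apply: esum_ge0 => i _; rewrite lee_fin powR_ge0.
Qed.

(** The cylinders given by the hypothesis are thinned out by [vitali_selection];
    the enlargements of the selected ones cover [U], and [packing_sum_small]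
    makes the sum of the [k]-th powers of their sizes as small as desired. *)
Lemma parabolic_premeasure_dense_eq0 (C : set X) (f : X -> R) (k eps : R)
    (U : set X) : measurable C -> measurable_fun C f -> (forall x, 0 <= f x) ->
  (\int[leb]_(x in C) (f x)%:E < +oo)%E ->
  k < N%:R + 2 -> 0 < eps ->
  (forall z, U z -> forall d, 0 < d -> exists r, [/\ 0 < r < d,
     pcylinder z r `<=` C &
     ((eps * r `^ k)%:E <= \int[leb]_(x in pcylinder z r) (f x)%:E)%E]) ->
  forall d, 0 < d -> parabolic_premeasure k d U = 0%E.
Proof.
move=> mC mf f0 foo kN eps0 UP d d0.
apply/eqP; rewrite eq_le parabolic_premeasure_ge0 andbT.
apply/lee_addgt0Pr => e e0; rewrite add0e.
have k3 : 0 < 3 `^ k :> R by exact: powR_gt0.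
have [d1 d10 d1P] := packing_sum_small mC mf f0 foo kN eps0 (divr_gt0 e0 k3).
have [rho rhoP] : {rho : X -> R & forall z, U z -> [/\ 0 < rho z < Num.min d1 (d / 3),
     pcylinder z (rho z) `<=` C & ((eps * rho z `^ k)%:E <=
       \int[leb]_(x in pcylinder z (rho z)) (f x)%:E)%E]}.
  apply: (@choice _ _ (fun z r => U z -> [/\ 0 < r < Num.min d1 (d / 3),
     pcylinder z r `<=` C & ((eps * r `^ k)%:E <=
       \int[leb]_(x in pcylinder z r) (f x)%:E)%E])) => z.
  have [Uz|nUz] := pselect (U z); last by exists 0.
  have [|r rP] := UP z Uz (Num.min d1 (d / 3)); last by exists r.
  by rewrite lt_min d10 divr_gt0.
have rho0 z : U z -> 0 < rho z by case/rhoP => /andP[].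
have [||G [GU tG dG]] := @vitali_selection R X X
  (fun z => pcylinder z (rho z)) rho d1 U.
- by move=> z /rho0 r0; exists z; exact: mem_pcylinder.
- move=> z /rhoP[/andP[r0 +] _ _]; rewrite lt_min => /andP[/ltW rd1 _].
  by rewrite r0.
have /countable_injP[h hinj] : countable G.
  by apply: (trivIset_pcylinder_countable _ tG) => z /GU/rho0.
(* hi inverts the numbering h of the selected cylinders *)
have [hi hiP] : {hi : nat -> X & forall z, G z -> hi (h z) = z}.
  have [hi hiP] : {hi : nat -> X & forall n, (h @` G) n -> G (hi n) /\ h (hi n) = n}.
    apply: (@choice _ _ (fun n (z : X) => (h @` G) n -> G z /\ h z = n)) => n.
    have [[z Gz hz]|nh] := pselect ((h @` G) n); first by exists z.
    by exists (0, 0).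
  exists hi => z Gz; have [|Ghz hhz] := hiP (h z); first by exists z.
  by apply: hinj => //; rewrite inE.
apply: (@le_trans _ _ (\esum_(i in h @` G) ((3 * rho (hi i)) `^ k)%:E)).
  apply: ereal_inf_lbound; exists (h @` G).
  exists (fun i => ((hi i).1, (hi i).2 + 4 * rho (hi i) ^+ 2)).
  exists (fun i => 3 * rho (hi i)); split => //.
    move=> _ [z Gz <-]; rewrite hiP//; have /rhoP[/andP[r0 +] _ _] := GU _ Gz.
    rewrite lt_min => /andP[_ rd]; rewrite mulr_gt0//= mulrC.
    by rewrite -ltr_pdivlMr.
  move=> z Uz; have [w Gw [zw rzw]] := dG z Uz; exists (h w); first by exists w.
  by rewrite hiP//; apply: pcylinder_engulf rzw zw; apply: rho0 => //; exact: GU.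
rewrite esum_image; last exact: hinj.
apply: ge_ereal_sup => _ [A [finA AG] <-].
rewrite fsbig_finite//= sumEFin lee_fin.
rewrite (eq_big_seq (fun z => 3 `^ k * rho z `^ k)); last first.
  move=> z; rewrite in_fset_set// inE => /AG Gz.
  by rewrite hiP// powRM// ltW//; apply: rho0; exact: GU.
rewrite -mulr_sumr mulrC -ler_pdivlMr//.
apply: d1P; first exact: finmap.fset_uniq.
  move=> z w /=; rewrite !in_fset_set// !inE => /AG Gz /AG Gw; exact: tG.
move=> z; rewrite in_fset_set// inE => /AG/GU/rhoP[/andP[r0 +] zC zf].
by rewrite lt_min => /andP[/ltW rd1 _]; split => //; rewrite r0.
Qed.

Lemma parabolic_premeasureS k d (U V : set X) : U `<=` V ->
  (parabolic_premeasure k d U <= parabolic_premeasure k d V)%E.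
Proof.
move=> UV; apply: ereal_inf_le_tmp => _ [I [z [r [rd VI ->]]]].
by exists I, z, r; split => //; exact: subset_trans VI.
Qed.

(** The [n]-th set is covered with total at most [e / 2 ^ n.+1], and the
    covering cylinders are renumbered along [nat * nat]. *)
Lemma parabolic_premeasure_bigcup_eq0 k d (U : nat -> set X) :
  (forall n, parabolic_premeasure k d (U n) = 0%E) ->
  parabolic_premeasure k d (\bigcup_n U n) = 0%E.
Proof.
move=> U0; apply/eqP; rewrite eq_le parabolic_premeasure_ge0 andbT.
apply/lee_addgt0Pr => e e0; rewrite add0e.
have cover n : exists c : set nat * (nat -> X) * (nat -> R),
    [/\ forall i, c.1.1 i -> 0 < c.2 i < d,
      U n `<=` \bigcup_(i in c.1.1) pcylinder (c.1.2 i) (c.2 i) &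
      (\esum_(i in c.1.1) (c.2 i `^ k)%:E <= (e / (2 ^ n.+1)%:R)%:E)%E].
  have en : (0 < e / (2 ^ n.+1)%:R) by rewrite divr_gt0// ltr0n expn_gt0.
  have := U0 n; rewrite /parabolic_premeasure => U0n.
  have fin : ereal_inf _ \is a fin_num := etrans (congr1 _ U0n) isT.
  have [_ [I [z [r [rd UI ->]]]]] := lb_ereal_inf_adherent en fin.
  by rewrite U0n add0e => /ltW le_en; exists (I, z, r).
have [c cP] := choice cover.
pose I := [set m | exists n i, (c n).1.1 i /\ m = pickle (n, i)].
pose un m : nat * nat := odflt (0, 0)%N (unpickle m).
have unK n i : un (pickle (n, i)) = (n, i) by rewrite /un pickleK.
apply: (@le_trans _ _ (\esum_(m in I) ((c (un m).1).2 (un m).2 `^ k)%:E)).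
  apply: ereal_inf_lbound; exists I, (fun m => (c (un m).1).1.2 (un m).2),
    (fun m => (c (un m).1).2 (un m).2); split => //.
    by move=> _ [n [i [ci ->]]]; rewrite unK/=; have [+ _ _] := cP n; apply.
  move=> x [n _ Ux]; have [_ + _] := cP n => /(_ _ Ux)[i ci xi].
  by exists (pickle (n, i)); [exists n, i|rewrite unK].
rewrite (@reindex_esum _ _ _ ([set: nat] `*`` (fun n => (c n).1.1)) _
    (fun ni : nat * nat => pickle ni)); last first.
  split.
  - by move=> [n i] [/= _ ci]; exists n, i.
  - by move=> x y _ _; exact: (pcan_inj pickleK).
  - by move=> _ [n [i [ci ->]]]; exists (n, i).
under eq_esum do rewrite /un pickleK/=.
rewrite -(@esum_esum _ _ _ setT (fun n => (c n).1.1)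
  (fun n i => ((c n).2 i `^ k)%:E)); last by move=> n i _ _; rewrite lee_fin powR_ge0.
apply: (@le_trans _ _ (\esum_(n in [set: nat]) (e / (2 ^ n.+1)%:R)%:E)).
  by apply: le_esum => n _; have [] := cP n.
rewrite -nneseries_esumT; last first.
  by move=> n; rewrite lee_fin divr_ge0 ?ltW// ler0n.
by have := epsilon_trick0 xpredT (ltW e0).
Qed.

Lemma parabolic_hausdorff_eq0 k (U : set X) :
  (forall d, 0 < d -> parabolic_premeasure k d U = 0%E) ->
  parabolic_hausdorff k U = 0%E.
Proof.
move=> U0; apply/cvg_lim => //; apply: (@cvg_near_cst _ _ _ _ _ _).
by near=> d; apply: U0; near: d; exact: nbhs_right_gt.
Unshelve. all: by end_near. Qed.

End density_covering.

(** * Points of positive parabolic density *)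

(** The form in which positive upper density is used and proved. *)
Lemma limf_esup_at_right_gt0 (R : realType) (h : R -> \bar R) :
  (0 < limf_esup h (0 : R)^'+)%E <-> exists2 e : R, 0 < e &
    forall d : R, 0 < d -> exists2 r : R, 0 < r < d & (e%:E <= h r)%E.
Proof.
rewrite limf_esupE; split.
  move=> h0; have [e e0 eh] : exists2 e : R, 0 < e &
      (e%:E < ereal_inf [set ereal_sup (h @` V) | V in (0 : R)^'+])%E.
    move: h0; case: ereal_inf => [x|_|//].
      by rewrite lte_fin => x0; exists (x / 2); rewrite ?lte_fin; lra.
    by exists 1; rewrite ?ltry.
  exists e => // d d0.
  have hd : (e%:E < ereal_sup (h @` [set r | 0 < r < d]%R))%E.
    apply: (lt_le_trans eh); apply: ereal_inf_lbound.
    exists [set r | 0 < r < d]%R => //; near=> r => /=; apply/andP; split.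
      by near: r; exact: nbhs_right_gt.
    by near: r; exact: nbhs_right_lt.
  have /ereal_sup_gt[_ [r rd <-] /ltW ehr] := hd.
  by exists r.
move=> [e e0 eh]; apply: (@lt_le_trans _ _ e%:E); first by rewrite lte_fin.
apply: le_ereal_inf_tmp => _ [V [d /= d0 dV] <-].
have [r /andP[r0 rd] ehr] := eh d d0.
apply: (le_trans ehr); apply: ereal_sup_ubound; exists r => //.
by apply: dV => //=; rewrite sub0r normrN gtr0_norm.
Unshelve. all: by end_near. Qed.

Section density_theorem.
Context {R : realType} {N : nat}.
Local Notation X := ('rV[R]_N * measurableTypeR R)%type.
Local Notation leb := (@lebesgue_rVR R N).

Definition upper_density (k : R) (f : X -> R) (z : X) : \bar R :=
  limf_esup (fun r : R => ((1 / r `^ k)%:E *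
    \int[leb]_(w in pcylinder z r) (f w)%:E)%E) (0 : R)^'+.

(** Local integrability on [E * ]0, T]], tested on the cylinders
    [cube y h * [t, T]] that stay away from the lateral boundary and from time
    [0].  The final time is included, as the cylinders [pcylinder] with vertex
    at time [T] reach it. *)
Definition integrable_cubes (E : set 'rV[R]_N) (T : R) (f : X -> R) :=
  forall (y : 'rV[R]_N) (h t : R), [set x : 'rV[R]_N | forall i, `|x ord0 i - y ord0 i| <= h / 2] `<=` E ->
    0 < t -> measurable_fun (cube y h `*` `[t, T] : set X) f /\
    (\int[leb]_(z in cube y h `*` `[t, T]) (f z)%:E < +oo)%E.

(** The set is split into countably many pieces, on each of which
    [parabolic_premeasure_dense_eq0] applies: a piece fixes a cube with rational
    center that contains the small cylinders around its points, and a lower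
    bound [1 / l.+1] for the density. *)
Theorem parabolic_premeasure_density_eq0 (E : set 'rV[R]_N) (T k : R)
    (f : X -> R) : open E -> k < N%:R + 2 -> (forall z, 0 <= f z) ->
  integrable_cubes E T f -> forall d, 0 < d ->
  parabolic_premeasure k d
    [set z | (E `*` `]0, T]) z /\ (0 < upper_density k f z)%E] = 0%E.
Proof.
move=> oE kN f0 intf d d0.
pose h (m : nat) : R := m.+1%:R^-1.
have h0 m : 0 < h m by rewrite invr_gt0.
have h1 m : h m <= 1 by rewrite invf_le1// ler1n.
pose Q (q : 'rV[rat]_N) m : set 'rV[R]_N :=
  [set x | forall i, `|x ord0 i - (map_mx ratr q) ord0 i| <= h m / 2].
pose U0 (q : 'rV[rat]_N) (m l : nat) : set X := [set z | [/\ Q q m `<=` E,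
    cube (map_mx ratr q) (h m / 2) z.1, 2 * h m < z.2 <= T &
    forall d, 0 < d -> exists2 r, 0 < r < d & 
      ((h l * r `^ k)%:E <= \int[leb]_(w in pcylinder z r) (f w)%:E)%E]].
pose un n : 'rV[rat]_N * nat * nat := odflt (0, 0%N, 0%N) (unpickle n).
pose U n := U0 (un n).1.1 (un n).1.2 (un n).2.
apply/eqP; rewrite eq_le parabolic_premeasure_ge0 andbT.
have U0E : parabolic_premeasure k d (\bigcup_n U n) = 0%E.
  apply: parabolic_premeasure_bigcup_eq0 => n; rewrite /U.
  move: (un n).1.1 (un n).1.2 (un n).2 => q m l.
  have [QE|nQE] := pselect (Q q m `<=` E); last first.
    apply/eqP; rewrite eq_le parabolic_premeasure_ge0 andbT.
    apply: ereal_inf_lbound; exists set0, (fun=> 0), (fun=> 0).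
    by rewrite esum_set0; split => // z [/nQE].
  have [mf foo] := intf _ _ _ QE (h0 m).
  apply: (parabolic_premeasure_dense_eq0 _ mf f0 foo kN (h0 l)) => //.
    by apply: measurableX => //; exact: measurable_cube.
  move=> z [_ zq /andP[zm zT] zdense] e e0.
  (* r <= h m / 2 keeps the cylinder in the cube; r ^+ 2 <= r <= h m keeps it
     after time h m *)
  have [|r /andP[r0 +] rf] := zdense (Num.min e (h m / 2)).
    by rewrite lt_min e0 divr_gt0.
  rewrite lt_min => /andP[re rh]; exists r; split => //; first by rewrite r0.
  move=> x [/= xz1]; rewrite in_itv/= => /andP[xz2 xz3]; split => /= [i|].
    have := ler_distD (z.1 ord0 i) (x.1 ord0 i) ((map_mx ratr q) ord0 i).
    have := xz1 i; have := zq i; lra.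
  rewrite in_itv/=; apply/andP; split; last exact: le_trans xz3 _.
  have := h1 m; have := h0 m; nra.
rewrite -[leRHS]U0E; apply: parabolic_premeasureS => z [[Ez]]; rewrite /= in_itv/= => /andP[z0 zT].
move=> /limf_esup_at_right_gt0[e e0 eP].
have /nbhs_ballP[a /= a0 aE] : nbhs z.1 E by exact: open_nbhs_nbhs.
have [m hm] : exists m, h m < Num.min a (z.2 / 2).
  have b0 : 0 < Num.min a (z.2 / 2) by rewrite lt_min a0 divr_gt0.
  have [m _ /(_ m (leqnn m)) mP] := near_infty_natSinv_lt (PosNum b0).
  by exists m.
have [l hl] : exists l, h l < e.
  have [l _ /(_ l (leqnn l)) lP] := near_infty_natSinv_lt (PosNum e0).
  by exists l.
move: hm; rewrite lt_min => /andP[hma hmz].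
have [q qP] : {q : 'I_N -> rat & forall j, `|z.1 ord0 j - ratr (q j)| < h m / 4}.
  apply: (@choice _ _ (fun j (q : rat) => `|z.1 ord0 j - ratr q| < h m / 4)) => j.
  have /rat_in_itvoo[b] : z.1 ord0 j - h m / 4 < z.1 ord0 j + h m / 4.
    by have := h0 m; lra.
  by rewrite in_itv/= => b2; exists b; rewrite distrC ltr_distl.
exists (pickle (\row_j q j, m, l)) => //; rewrite /U /un pickleK/=; split.
- move=> x xq; apply: aE; split => // i j; rewrite ord1 /ball/=.
  have := xq j; rewrite !mxE; have := qP j.
  have := ler_distD (ratr (q j)) (z.1 ord0 j) (x ord0 j).
  rewrite (distrC (ratr (q j) : R)); have := h0 m; lra.
- move=> i; rewrite !mxE; apply: (lt_le_trans (qP i)); lra.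
- by rewrite zT andbT; lra.
- move=> b b0; have [r /andP[r0 rb] er] := eP b b0; exists r; first by rewrite r0.
  have rk : 0 < r `^ k by exact: powR_gt0.
  apply: (@le_trans _ _ (e * r `^ k)%:E).
    by rewrite lee_fin ler_pM2r// ltW.
  by move: er; rewrite mul1r lee_pdivlMl// -EFinM mulrC.
Qed.

End density_theorem.

(** * Smooth cutoffs *)

Section bump.
Context {R : realType}.
Implicit Types (f : R -> R) (tau a b c t : R).

Lemma is_derive_cvg (V : normedModType R) (f : V -> R) x v l :
  h^-1 *: (f (h *: v + x) - f x) @[h --> (0 : R)^'] --> l -> is_derive x v f l.
Proof.
move=> fl; apply: DeriveDef; first by apply/cvg_ex; exists l.
by apply/cvg_lim.
Qed.

(** [t ^- n * exp (- tau / t)], extended by [0] to [t <= 0].  These functions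
    are flat at [0] and their span is stable under differentiation, whence
    smoothness.  The parameter [tau] makes them increase to the indicator of
    [t > 0] when [n = 0] and [tau] tends to [0]. *)
Definition flat tau (n : nat) t : R :=
  if 0 < t then t^-1 ^+ n * expR (- (tau * t^-1)) else 0.

(** From [y ^+ n.+2 / n.+2`! <= expR y] with [y = tau / t]. *)
Lemma flat_le tau n t : 0 < tau ->
  `|flat tau n t| <= (n.+2)`!%:R / tau ^+ n.+2 * t ^+ 2.
Proof.
move=> tau0; rewrite /flat; case: ifPn => [t0|_]; last first.
  by rewrite normr0 mulr_ge0// ?sqr_ge0// divr_ge0// exprn_ge0// ltW.
have y0 : 0 < tau * t^-1 by rewrite mulr_gt0// invr_gt0.
have tn0 : 0 < t^-1 ^+ n by rewrite exprn_gt0// invr_gt0.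
rewrite ger0_norm; last by rewrite mulr_ge0 ?expR_ge0// ltW.
have := expR_ge1Dxn n.+1 (ltW y0) => /(le_trans _).
move=> /(_ ((tau * t^-1) ^+ n.+2 / (n.+2)`!%:R)).
rewrite lerDr ler01 => /(_ isT) ey.
rewrite expRN -ler_pdivlMl//.
have f0 : 0 < (n.+2)`!%:R :> R by rewrite ltr0n fact_gt0.
have p0 : 0 < (tau * t^-1) ^+ n.+2 / (n.+2)`!%:R by rewrite divr_gt0// exprn_gt0.
have -> : (t^-1 ^+ n)^-1 * ((n.+2)`!%:R / tau ^+ n.+2 * t ^+ 2) =
    ((tau * t^-1) ^+ n.+2 / (n.+2)`!%:R)^-1.
  rewrite exprMn !exprVn !exprS; field.
  by rewrite !expf_neq0 ?gt_eqF// !mulf_neq0// ?expf_neq0 ?gt_eqF.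
by rewrite lef_pV2// posrE// (lt_le_trans p0).
Qed.

Lemma is_derive_flat tau n t : 0 < tau ->
  is_derive t 1 (flat tau n) (tau * flat tau n.+2 t - n%:R * flat tau n.+1 t).
Proof.
move=> tau0; have [t0|t0|->] := ltgtP t 0.
- rewrite /flat ltNge (ltW t0)/= !mulr0 subr0.
  apply: (@near_eq_is_derive _ _ _ (cst 0)).
  by near=> s; rewrite ltNge ifF//; apply/negbF/ltW; near: s; exact: lt_nbhsl.
- have dV : is_derive t 1 (fun s : R => s^-1) (- t ^- 2).
    apply: is_derive_eq (is_deriveV _ (is_derive_id t 1)) _.
      by rewrite gt_eqF.
    by rewrite /GRing.scale/= mulr1.
  have dE := @is_derive1_comp _ _ (- (tau \*: (fun s : R => s^-1))) t _ _
    (is_derive_expR (- (tau * t^-1))) (is_deriveN (is_deriveZ tau dV)).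
  have dM := is_deriveM (is_deriveX n dV) dE.
  have nearE : \near t, ((fun s : R => s^-1) ^+ n *
      (expR \o - (tau \*: (fun s : R => s^-1)))) t = flat tau n t.
    near=> s; rewrite /flat ifT; last by near: s; exact: lt_nbhsr.
    by rewrite mulrfctE exprfctE.
  apply: is_derive_eq (near_eq_is_derive nearE dM) _.
  rewrite !exprfctE /flat t0 /= -exprVn /GRing.scale/=.
  by case: n {dM nearE} => [|n]; rewrite /= ?expr0 ?exprS; ring.
- rewrite {2 3}/flat ltxx !mulr0 subr0.
  apply: is_derive_cvg; rewrite {2}/flat ltxx.
  set K := (n.+2)`!%:R / tau ^+ n.+2.
  have K0 : 0 <= K by rewrite divr_ge0// exprn_ge0// ltW.
  apply/cvgrPdist_lt => e e0; near=> h.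
  rewrite sub0r normrN addr0 subr0 /GRing.scale/= mulr1 normrM normfV.
  have h0 : 0 < `|h| by rewrite normr_gt0; near: h; exact: nbhs_dnbhs_neq.
  rewrite ltr_pdivrMl//; apply: (le_lt_trans (flat_le n h tau0)); rewrite -/K.
  have hK : `|h| < e / (K + 1).
    by near: h; apply: dnbhs0_lt; rewrite divr_gt0// ltr_wpDl.
  rewrite -real_normK ?num_real// expr2 mulrCA ltr_pM2l//.
  by move: hK; rewrite ltr_pdivlMr ?ltr_wpDl//; nra.
Unshelve. all: by end_near. Qed.

(** A class of functions that contains [bump_fun tau a b] and is stable under
    differentiation. *)
Inductive flat_span tau a b : (R -> R) -> Prop :=
| flat_span_mono c m n :
    flat_span tau a b (fun t => c * (flat tau m (t - a) * flat tau n (b - t)))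
| flat_span_add f g : flat_span tau a b f -> flat_span tau a b g ->
    flat_span tau a b (fun t => f t + g t).

Lemma flat_span_derive tau a b f : 0 < tau -> flat_span tau a b f ->
  exists2 f', flat_span tau a b f' & forall t, is_derive t 1 f (f' t).
Proof.
move=> tau0; elim=> [c m n|g h _ [g' sg dg] _ [h' sh dh]]; last first.
  exists (fun t => g' t + h' t); first exact: flat_span_add.
  by move=> t; exact: is_deriveD.
pose B c m n t := c * (flat tau m (t - a) * flat tau n (b - t)).
exists (fun t => (B (c * tau) m.+2 n t + B (- (c * m%:R)) m.+1 n t) +
                 (B (- (c * tau)) m n.+2 t + B (c * n%:R) m n.+1 t)).
  by apply: flat_span_add; apply: flat_span_add; exact: flat_span_mono.
move=> t.
have dl : is_derive t 1 (fun s => s - a) 1.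
  by apply: is_derive_eq (is_deriveB (is_derive_id t 1) (is_derive_cst a t 1)) _;
    rewrite subr0.
have dr : is_derive t 1 (fun s => b - s) (- 1).
  by apply: is_derive_eq (is_deriveB (is_derive_cst b t 1) (is_derive_id t 1)) _;
    rewrite sub0r.
have dfl := @is_derive1_comp _ _ (fun s => s - a) t _ _ (is_derive_flat m (t - a) tau0) dl.
have dfr := @is_derive1_comp _ _ (fun s => b - s) t _ _ (is_derive_flat n (b - t) tau0) dr.
apply: is_derive_eq (is_deriveZ c (is_deriveM dfl dfr)) _.
by rewrite /B /GRing.scale /=; ring.
Qed.

Definition smooth f := forall n t, derivable (derive1n n f) t 1.

Lemma flat_span_smooth tau a b f : 0 < tau -> flat_span tau a b f -> smooth f.
Proof.
move=> tau0 sf n t.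
suff /(flat_span_derive tau0)[f' _ /(_ t)[]] : flat_span tau a b (derive1n n f) by [].
elim: n => [//|n /(flat_span_derive tau0)[f' sf' df']].
rewrite derive1nS (_ : derive1 _ = f')//.
by apply/funext => s; rewrite derive1E; have [] := df' s.
Qed.

Definition bump_fun tau a b t : R := flat tau 0 (t - a) * flat tau 0 (b - t).

Lemma bump_smooth tau a b : 0 < tau -> smooth (bump_fun tau a b).
Proof.
move=> tau0; apply: (flat_span_smooth tau0).
rewrite (_ : bump_fun tau a b = fun t => 1 * (flat tau 0 (t - a) * flat tau 0 (b - t))).
  exact: flat_span_mono.
by apply/funext => t; rewrite mul1r.
Qed.

Lemma flat0_bound tau t : 0 < tau -> 0 <= flat tau 0 t <= 1.
Proof.
move=> tau0; rewrite /flat; case: ifPn => [t0|_]; last by rewrite lexx ler01.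
rewrite expr0 mul1r expR_ge0/= expR_le1 oppr_le0 mulr_ge0// ?ltW//.
by rewrite invr_gt0.
Qed.

Lemma bump_bound tau a b t : 0 < tau -> 0 <= bump_fun tau a b t <= 1.
Proof.
move=> tau0; rewrite /bump_fun.
have /andP[? ?] := flat0_bound (t - a) tau0.
have /andP[? ?] := flat0_bound (b - t) tau0.
by rewrite mulr_ge0//= mulr_ile1.
Qed.

Lemma bump_out tau a b t : ~~ (a < t < b) -> bump_fun tau a b t = 0.
Proof.
rewrite /bump_fun /flat !subr_gt0 => abt.
by case: ifPn => // a_t; case: ifPn => // t_b; rewrite ?mulr0 ?mul0r//;
  rewrite a_t t_b in abt.
Qed.

Lemma bump_cvg a b t :
  bump_fun (n.+1%:R^-1) a b t @[n --> \oo] --> (if a < t < b then 1 else 0 : R).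
Proof.
have h0 : (n.+1%:R^-1 : R) @[n --> \oo] --> (0 : R) by exact: cvg_harmonic.
case: ifPn => [/andP[at0 tb0]|abt]; last first.
  by under eq_fun do rewrite bump_out//; exact: cvg_cst.
have E s : expR (- (n.+1%:R^-1 * s)) @[n --> \oo] --> (1 : R).
  suff : expR (- (n.+1%:R^-1 * s)) @[n --> \oo] --> expR (- (0 * s)).
    by rewrite mul0r oppr0 expR0.
  apply: continuous_cvg; first exact: continuous_expR.
  by apply: cvgN; apply: cvgMl.
under eq_fun do rewrite /bump_fun /flat !subr_gt0 at0 tb0 !expr0 !mul1r.
by have := cvgM (E (t - a)^-1) (E (b - t)^-1); rewrite mulr1; apply.
Qed.

End bump.

Section tensor_product.
Context {R : realType} {N : nat}.
Implicit Types (F : 'I_N -> R -> R) (x : 'rV[R]_N).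

Definition tensor F x : R := \prod_(i < N) F i (x ord0 i).

(** Along the [j]-th axis only the [j]-th factor varies. *)
Lemma is_derive_tensor F x (j : 'I_N) :
  (forall i t, derivable (F i) t 1) ->
  is_derive x (unit_rV j) (tensor F)
    (tensor (fun i => if i == j then derive1 (F i) else F i) x).
Proof.
move=> dF; apply: is_derive_cvg.
set c := \prod_(i < N | i != j) F i (x ord0 i).
have coordE (h : R) i :
    (h *: unit_rV j + x) ord0 i = if i == j then h + x ord0 j else x ord0 i.
  rewrite /unit_rV !mxE /= ; have [->|] := eqVneq i j; first by rewrite mulr1.
  by rewrite mulr0 add0r.
rewrite (_ : (fun h : R => _) = (fun h : R =>
    c * (h^-1 *: (F j (h *: 1 + x ord0 j) - F j (x ord0 j))))); last first.
  apply/funext => h.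
  rewrite /tensor (bigD1 j)//= [X in _ - X](bigD1 j)//= coordE eqxx.
  rewrite [X in _ * X - _](_ : _ = c); last first.
    by apply: eq_bigr => i ij; rewrite coordE (negbTE ij).
  by rewrite -mulrBl /GRing.scale/= mulr1 -/c; ring.
rewrite /tensor (bigD1 j)//= eqxx mulrC.
rewrite [X in X * _](_ : _ = c); last first.
  by apply: eq_bigr => i /negbTE ->.
apply: cvgMr; rewrite derive1E; exact: (dF j (x ord0 j)).
Qed.

Lemma partial_tensor F (j : 'I_N) : (forall i t, derivable (F i) t 1) ->
  partial j (tensor F) =
  tensor (fun i => if i == j then derive1 (F i) else F i).
Proof.
by move=> dF; apply/funext => x; have [] := is_derive_tensor x j dF.
Qed.

Lemma continuous_tensor F : (forall i t, derivable (F i) t 1) ->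
  continuous (tensor F).
Proof.
move=> dF; apply: continuous_big => [|i _].
  by move=> x; apply: cvgM; [exact: cvg_fst|exact: cvg_snd].
move=> x; apply: (@continuous_comp _ _ _ (fun x : 'rV[R]_N => x ord0 i) (F i)).
  exact: coord_continuous.
exact/differentiable_continuous/derivable1_diffP.
Qed.

(** An iterated partial derivative of a tensor product is the tensor product of
    higher derivatives of the factors. *)
Lemma tensor_smooth F : (forall i, smooth (F i)) -> smooth_rV (tensor F).
Proof.
move=> sF s.
have [n ->] : exists n : 'I_N -> nat,
    foldr (@partial R N) (tensor F) s = tensor (fun i => derive1n (n i) (F i)).
  elim: s => [|j s [n /= ->]]; first by exists (fun=> 0%N).
  exists (fun i => if i == j then (n i).+1 else n i).
  rewrite partial_tensor; last by move=> i t; exact: sF.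
  by congr tensor; apply/funext => i; case: (i == j).
split; first by apply: continuous_tensor => i t; exact: sF.
move=> x i; have [] // := @is_derive_tensor (fun i => derive1n (n i) (F i)) x i _.
by move=> k t; exact: sF.
Qed.

End tensor_product.

(** * Functions whose integrals over all boxes vanish *)

Section boxes.
Context {R : realType} {N : nat}.
Implicit Types (c : 'I_N -> \bar R) (a b : 'I_N -> R).

Definition open_box a b : set 'rV[R]_N :=
  [set x | forall i, `]a i, b i[%classic (x ord0 i)].

Definition closed_box a b : set 'rV[R]_N :=
  [set x | forall i, `[a i, b i]%classic (x ord0 i)].

Lemma measurable_open_box a b : measurable (open_box a b).
Proof.
by apply: (@measurable_box _ _ (fun i : 'I_N => `]a i, b i[%classic)) => i.
Qed.

Lemma measurable_closed_box a b : measurable (closed_box a b).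
Proof.
by apply: (@measurable_box _ _ (fun i : 'I_N => `[a i, b i]%classic)) => i.
Qed.

Lemma compact_closed_box a b : compact (closed_box a b).
Proof.
apply: (@rV_compact _ _ (fun i : 'I_N => `[a i, b i]%classic)) => i.
exact: segment_compact.
Qed.

Lemma open_box_closed a b : open_box a b `<=` closed_box a b.
Proof. by move=> x xab i; exact: subset_itv_oo_cc (xab i). Qed.

Definition orthant c : set 'rV[R]_N := [set x | forall i, (c i < (x ord0 i)%:E)%E].

(** Orthants, with [-oo] allowed as a bound, form a pi-system that contains the
    whole space and generates the product sigma-algebra; their intersections
    with an open box are open boxes or empty. *)
Lemma measurable_rV_orthants :
  @measurable _ 'rV[R]_N = <<s [set orthant c | c in [set: 'I_N -> \bar R]] >>.
Proof.
apply/seteqP; split => A.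
  move=> mA; set G := [set orthant c | c in _].
  suff : measurable_fun setT (id : g_sigma_algebraType G -> 'rV[R]_N).
    by move=> /(_ measurableT A mA); rewrite setTI.
  apply: measurable_fun_rV => i.
  apply: (measurability _ (RGenOInfty.measurableE R)) => _ [_ [s ->] <-].
  rewrite setTI; apply: sub_sigma_algebra.
  exists (fun j => if j == i then s%:E else -oo%E) => //.
  apply/seteqP; split => x /=.
    by move=> /(_ i); rewrite eqxx lte_fin in_itv/= andbT.
  rewrite in_itv/= andbT => sx j; case: ifPn => [/eqP ->|_]; last exact: ltNyr.
  by rewrite lte_fin.
move: A; apply: smallest_sub; first exact: sigma_algebra_measurable.
move=> _ [c _ <-].
suff mc i : measurable [set t : R | (c i < t%:E)%E] by exact: measurable_box mc.
rewrite (_ : [set t | _] = EFin @^-1` `]c i, +oo[%classic); last first.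
  by apply/seteqP; split => t /=; rewrite in_itv/= andbT.
by rewrite -[X in measurable X]setTI; apply: EFin_measurable => //; exact: emeasurable_itv.
Qed.

Lemma setI_closed_orthants :
  setI_closed [set orthant c | c in [set: 'I_N -> \bar R]].
Proof.
move=> _ _ [c _ <-] [d _ <-].
exists (fun i => maxe (c i) (d i)) => //; apply/seteqP; split => x /=.
  move=> cdx; split => i; have := cdx i; rewrite gt_max => /andP[]//.
by move=> [cx dx] i; rewrite gt_max cx dx.
Qed.

(** The sets [A] with zero integral of [f] over [A] intersected with the box
    form a Dynkin system that contains the orthants, hence all measurable sets. *)
Lemma ae_eq0_open_box a b (f : 'rV[R]_N -> \bar R) :
  (lebesgue_rV N).-integrable (open_box a b) f ->
  (forall a' b', open_box a' b' `<=` open_box a b ->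
     (\int[lebesgue_rV N]_(x in open_box a' b') f x = 0)%E) ->
  ae_eq (lebesgue_rV N) (open_box a b) f (cst 0%E).
Proof.
move=> intf f0; set K := open_box a b; have mK : measurable K := measurable_open_box a b.
have IK : (\int[lebesgue_rV N]_(x in K) f x = 0)%E by exact: f0.
apply: integral_ae_eq => // D DK mD; rewrite integral_cst// mul0e.
have -> : D = D `&` K by apply/esym/setIidPl.
move: mD; rewrite measurable_rV_orthants => mD; move: D mD {DK}.
apply: dynkin_induction => //=.
- exact: measurable_rV_orthants.
- exact: setI_closed_orthants.
- by rewrite setTI.
- move=> _ [c _ <-].
  have [cfin|/existsNP[i ci]] := pselect (forall i, (c i < +oo)%E); last first.
    rewrite (_ : _ `&` _ = set0) ?integral_set0//; apply/seteqP; split => // x [+ _].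
    by move=> /(_ i) /ltW cx; apply: ci; apply: le_lt_trans cx (ltry _).
  have cmax i t : (fine (maxe (c i) (a i)%:E) < t) = (c i < t%:E)%E && (a i < t).
    rewrite -lte_fin fineK ?gt_max ?lte_fin// fin_numElt.
    by rewrite lt_max ltNyr orbT gt_max cfin ltry.
  rewrite (_ : _ `&` _ = open_box (fun i => fine (maxe (c i) (a i)%:E)) b).
    apply: f0 => x xcb i; have := xcb i; rewrite /= !in_itv/= cmax.
    by move=> /andP[/andP[_ ->] ->].
  apply/seteqP; split => x /=.
    move=> [cx xab] i; have := xab i; have := cx i; rewrite /= !in_itv/= cmax.
    by move=> -> /andP[-> ->].
  move=> xcb; split => i; have := xcb i; rewrite /= !in_itv/= cmax.
    by move=> /andP[/andP[]].
  by move=> /andP[/andP[_ ->] ->].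
- move=> S mS SK.
  have intS : (lebesgue_rV N).-integrable (S `&` K) f.
    by apply: integrableS intf => //; exact: measurableI.
  have intCS : (lebesgue_rV N).-integrable (~` S `&` K) f.
    by apply: integrableS intf => //; apply: measurableI => //; exact: measurableC.
  have := IK; rewrite -[in X in X = _](setTI K) -(setvU S) setIUl integral_setU.
  - by rewrite SK adde0.
  - by apply: measurableI => //; exact: measurableC.
  - exact: measurableI.
  - by rewrite -setIUl setvU setTI; exact: measurable_int intf.
  - by apply/disj_setPRL => x [Sx _] [].
- move=> F mF tF FK; rewrite setI_bigcupl integral_bigcup//.
  + by rewrite eseries0// => i _ _; exact: FK.
  + exact: trivIset_setIr.
  + by move=> i; exact: measurableI.
  + apply: integrableS intf => //; first by apply: bigcup_measurable => i _; exact: measurableI.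
    by apply: bigcup_sub => i _; exact: subIsetr.
Qed.

End boxes.

(** * Uniqueness of weak gradients on a time slice *)

Section weak_gradient_unique.
Context {R : realType} {N : nat}.
Implicit Types (a b : 'I_N -> R).
Local Notation leb := (lebesgue_rV N).

(** Smooth functions between [0] and [1], supported in a box, that converge to
    its indicator as [n] tends to infinity. *)
Definition cutoff (n : nat) a b : 'rV[R]_N -> R :=
  tensor (fun i => bump_fun n.+1%:R^-1 (a i) (b i)).

Lemma cutoff_bound n a b x : 0 <= cutoff n a b x <= 1.
Proof.
have bb i : 0 <= bump_fun n.+1%:R^-1 (a i) (b i) (x ord0 i) <= 1.
  by apply: bump_bound; rewrite invr_gt0.
by rewrite /cutoff /tensor prodr_ge0 ?prodr_ile1// => i _; case/andP: (bb i).
Qed.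

Lemma cutoff_out n a b x : ~ open_box a b x -> cutoff n a b x = 0.
Proof.
move=> /existsNP[i abi]; rewrite /cutoff /tensor (bigD1 i)//= bump_out ?mul0r//.
by apply/negP => abx; apply: abi; rewrite /= in_itv.
Qed.

Lemma cutoff_cvg a b x : open_box a b x -> cutoff n a b x @[n --> \oo] --> (1 : R).
Proof.
move=> abx.
suff : cutoff n a b x @[n --> \oo] --> \prod_(i < N) (1 : R) by rewrite big1.
apply: cvg_big => [|i _]; first by move=> y; apply: cvgM; [exact: cvg_fst|exact: cvg_snd].
have := @bump_cvg R (a i) (b i) (x ord0 i).
by have := abx i; rewrite /= in_itv/= => ->.
Qed.

Lemma measurable_cutoff n a b D : measurable_fun D (cutoff n a b).
Proof.
apply: measurable_funTS; rewrite /cutoff /tensor.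
elim: (index_enum _) => [|i s IHs].
  by under eq_fun do rewrite big_nil; exact: measurable_cst.
under eq_fun do rewrite big_cons; apply: measurable_funM => //.
apply: (measurableT_comp _ (measurable_coord i)).
apply: continuous_measurable_fun => t.
apply/differentiable_continuous/derivable1_diffP.
have n0 : 0 < n.+1%:R^-1 :> R by rewrite invr_gt0.
exact: (@bump_smooth R _ (a i) (b i) n0 0%N t).
Qed.

Lemma cutoff_test n E a b a' b' : closed_box a b `<=` E ->
  open_box a' b' `<=` open_box a b -> Cc_infty E (cutoff n a' b').
Proof.
move=> abE ab; split.
  by apply: tensor_smooth => i; apply: bump_smooth; rewrite invr_gt0.
exists (closed_box a b); split => //; first exact: compact_closed_box.
move=> x nx; apply: cutoff_out => /ab/open_box_closed; exact: nx.
Qed.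

Lemma integral_cutoff_cvg a b (h : 'rV[R]_N -> R) :
  leb.-integrable (open_box a b) (EFin \o h) ->
  (\int[leb]_(x in open_box a b) (h x * cutoff n a b x)%:E)%E @[n --> \oo] -->
  (\int[leb]_(x in open_box a b) (h x)%:E)%E.
Proof.
move=> inth; have mK := measurable_open_box a b.
have mh : measurable_fun (open_box a b) h.
  by apply/measurable_EFinP; exact: measurable_int inth.
have [] // := @dominated_convergence _ _ _ leb _ mK
  (fun n x => (h x * cutoff n a b x)%:E) (EFin \o h) (abse \o EFin \o h).
- move=> n; apply/measurable_EFinP; apply: measurable_funM => //.
  exact: measurable_cutoff.
- exact/measurable_EFinP.
- apply: aeW => x abx; apply: cvg_EFin; first exact: nearW.
  by have := cvgM (cvg_cst (h x)) (cutoff_cvg abx); rewrite mulr1; apply.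
- exact: integrable_abse.
- apply: aeW => x n _; rewrite /= lee_fin normrM ler_piMr//.
  by have /andP[c0 c1] := cutoff_bound n a b x; rewrite ger0_norm.
Qed.

(** Testing with [cutoff n a' b'] and letting [n] tend to infinity shows that
    [g1] and [g2] have the same integral over each box inside [open_box a b]. *)
Lemma weak_gradient_unique (E : set 'rV[R]_N) (v : 'rV[R]_N -> \bar R)
    (g1 g2 : 'rV[R]_N -> 'rV[R]_N) a b (i : 'I_N) :
  closed_box a b `<=` E -> weak_gradient E v g1 -> weak_gradient E v g2 ->
  leb.-integrable (open_box a b) (fun x => (g1 x ord0 i)%:E) ->
  leb.-integrable (open_box a b) (fun x => (g2 x ord0 i)%:E) ->
  ae_eq leb (open_box a b) (fun x => (g1 x ord0 i)%:E)
    (fun x => (g2 x ord0 i)%:E).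
Proof.
move=> abE vg1 vg2 int1 int2; have mK := measurable_open_box a b.
have h0 := integrableB mK int1 int2.
have : ae_eq leb (open_box a b)
    (fun x => (g1 x ord0 i)%:E - (g2 x ord0 i)%:E)%E (cst 0%E).
  apply: ae_eq0_open_box => // a' b' ab'; have mK' := measurable_open_box a' b'.
  have i1 := integrableS mK mK' ab' int1; have i2 := integrableS mK mK' ab' int2.
  have supp (g : 'rV[R]_N -> 'rV[R]_N) n :
      (\int[leb]_(x in E) (g x ord0 i * cutoff n a' b' x)%:E =
       \int[leb]_(x in open_box a' b') (g x ord0 i * cutoff n a' b' x)%:E)%E.
    rewrite integral_mkcond [RHS]integral_mkcond; apply: eq_integral => x _.
    rewrite !patchE; have [xab|xab] := pselect (open_box a' b' x).
      by rewrite !ifT// inE//; exact/abE/open_box_closed/ab'.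
    by rewrite [in RHS]ifF ?cutoff_out ?mulr0 ?if_same//; exact: memNset.
  suff eq12 : (\int[leb]_(x in open_box a' b') (g1 x ord0 i)%:E =
      \int[leb]_(x in open_box a' b') (g2 x ord0 i)%:E)%E.
    by rewrite integralB// eq12 subee//; exact: integrable_fin_num.
  have c1 := integral_cutoff_cvg i1; have c2 := integral_cutoff_cvg i2.
  apply: cvg_unique c1 _ => //.
  rewrite (_ : (fun n => _) = (fun n => \int[leb]_(x in open_box a' b')
     (g2 x ord0 i * cutoff n a' b' x)%:E)%E)//.
  apply/funext => n; rewrite -!supp.
  have ct := cutoff_test n abE ab'.
  by apply: oppe_inj; rewrite -(vg1 _ ct i) -(vg2 _ ct i).
apply: filterS => x /[apply] /=; rewrite -EFinB => -[] /eqP.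
by rewrite subr_eq0 => /eqP ->.
Qed.

End weak_gradient_unique.

(** * Uniqueness of spatial gradients in space-time *)

Section slices.
Context {R : realType}.
Local Notation leb1 := (@lebesgue_measure R).

Lemma sigma_finite_lebesgue_rV n : sigma_finite setT (@lebesgue_rV R n).
Proof.
pose B (k : nat) := open_box (fun=> - k%:R : R) (fun _ : 'I_n => k%:R).
exists B.
  apply/esym/seteqP; split => // x _.
  pose M := \sum_(i < n) `|x ord0 i|.
  exists (Num.truncn M).+1 => // i /=.
  rewrite in_itv/= -ltr_norml.
  have xM : `|x ord0 i| <= M by rewrite /M (bigD1 i)//= lerDl sumr_ge0.
  apply: le_lt_trans xM _; exact: truncnS_gt.
move=> k; split; first exact: measurable_open_box.
rewrite (@lebesgue_rV_box _ _ (fun _ : 'I_n => `]- k%:R, (k%:R : R)[%classic)).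
  rewrite (eq_bigr (fun=> (k%:R + k%:R : R)%:E)) ?prodEFin ?ltry// => i _.
  rewrite lebesgue_measure_itv/= lte_fin; case: ltP => [_|kk]; first by rewrite -EFinB opprK.
  by congr EFin; have := ler0n R k; lra.
by move=> i; exact: measurable_itv.
Qed.

(** A copy of [lebesgue_rV] to carry the sigma-finite structure that Tonelli's
    theorem requires. *)
Definition lebesgue_rV_sigma n : set 'rV[R]_n -> \bar R := lebesgue_rV n.
Arguments lebesgue_rV_sigma : clear implicits.

HB.instance Definition _ n := isMeasure.Build _ _ _ (lebesgue_rV_sigma n)
  (measure0 (lebesgue_rV n)) (measure_ge0 (lebesgue_rV n))
  (@measure_semi_sigma_additive _ _ _ (lebesgue_rV n)).

HB.instance Definition _ n := Measure_isSigmaFinite.Build _ _ _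
  (lebesgue_rV_sigma n) (sigma_finite_lebesgue_rV n).

Context {N : nat}.
Local Notation X := ('rV[R]_N * measurableTypeR R)%type.
Local Notation leb := (@lebesgue_rVR R N).

Lemma integral_lebesgue_rVR (f : X -> \bar R) : measurable_fun setT f ->
  (forall z, 0 <= f z)%E ->
  (\int[leb]_z f z = \int[leb1]_t \int[lebesgue_rV N]_x f (x, t))%E.
Proof.
move=> mf f0.
exact: (@fubini_tonelli2 _ _ _ _ _ (lebesgue_rV_sigma N) leb1 f mf f0).
Qed.

Lemma measurable_integral_slice (f : X -> \bar R) : measurable_fun setT f ->
  (forall z, 0 <= f z)%E ->
  measurable_fun setT (fun t : measurableTypeR R => \int[lebesgue_rV N]_x f (x, t))%E.
Proof.
move=> mf f0.
exact: (@measurable_fun_fubini_tonelli_G _ _ _ _ _ (lebesgue_rV_sigma N) f mf f0).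
Qed.

Lemma ae_integrable_slice (f : X -> \bar R) (K : set 'rV[R]_N)
    (I : set (measurableTypeR R)) : measurable K -> measurable I ->
  leb.-integrable (K `*` I) f ->
  {ae leb1, forall t, I t -> (lebesgue_rV N).-integrable K (fun x => f (x, t))}.
Proof.
move=> mK mI intf.
have intfT : leb.-integrable setT (f \_ (K `*` I)).
  exact/(integrable_mkcond _ (measurableX mK mI)).
have := @ae_integrable2 _ _ _ _ _ (lebesgue_rV_sigma N) leb1 _ intfT.
apply: filterS => t intt It; apply/(integrable_mkcond _ mK).
rewrite (_ : _ \_ K = fun x => (f \_ (K `*` I)) (x, t)); first exact: intt.
apply/funext => x; rewrite !patchE; congr (if _ then _ else _).
by apply/idP/idP => /set_mem h; apply/mem_set; [split|case: h].
Qed.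

(** On almost every time slice the two gradients agree almost everywhere by
    [weak_gradient_unique], and both integrals are computed slicewise. *)
Lemma integral_eq_spatial_gradient (E : set 'rV[R]_N) (T : R)
    (v : 'rV[R]_N * R -> \bar R) (g1 g2 : 'rV[R]_N * R -> 'rV[R]_N)
    (Phi : 'rV[R]_N -> R) (a b : 'I_N -> R) (t0 : R) :
  spatial_gradient E T v g1 -> spatial_gradient E T v g2 ->
  closed_box a b `<=` E -> 0 < t0 -> (forall w, 0 <= Phi w) ->
  measurable_fun (open_box a b `*` `[t0, T] : set X) (Phi \o g1) ->
  measurable_fun (open_box a b `*` `[t0, T] : set X) (Phi \o g2) ->
  (\int[leb]_(z in open_box a b `*` `[t0, T]) (Phi (g1 z))%:E =
   \int[leb]_(z in open_box a b `*` `[t0, T]) (Phi (g2 z))%:E)%E.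
Proof.
move=> [_ g1L1 vg1] [_ g2L1 vg2] abE t00 Phi0 m1 m2.
set K := open_box a b; set I : set (measurableTypeR R) := `[t0, T]%classic.
have mK : measurable K := measurable_open_box a b.
have mI : measurable I by exact: measurable_itv.
have mKI : measurable (K `*` I) by exact: measurableX.
have int_coord (g : 'rV[R]_N * R -> 'rV[R]_N) i :
    Lp_loc_cyl E T 1 (fun z => (g z ord0 i)%:E) ->
    leb.-integrable (K `*` I) (fun z : X => (g z ord0 i)%:E).
  move=> /(_ (closed_box a b) t0 T (@compact_closed_box _ _ a b) abE t00 (lexx _)).
  move=> [mg goo].
  have : leb.-integrable (closed_box a b `*` I) (fun z : X => (g z ord0 i)%:E).
    apply/integrableP; split => //; apply: le_lt_trans goo.
    by under [leRHS]eq_integral do rewrite poweRe1//.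
  apply: integrableS => //.
    by apply: measurableX => //; exact: measurable_closed_box.
  by move=> z [Kz Iz]; split => //; exact: open_box_closed.
have ae_coord i : {ae leb1, forall t, I t ->
    ae_eq (lebesgue_rV N) K (fun x => (g1 (x, t) ord0 i)%:E)
      (fun x => (g2 (x, t) ord0 i)%:E)}.
  have s1 := ae_integrable_slice mK mI (int_coord _ _ (g1L1 i)).
  have s2 := ae_integrable_slice mK mI (int_coord _ _ (g2L1 i)).
  (* weak gradients are given for t < T, the slice t = T is negligible *)
  have tT : {ae leb1, forall t : R, t != T}.
    exists [set T]; split => //; first exact: lebesgue_measure_set1.
    by move=> t /= /negP; rewrite negbK => /eqP.
  have FF : Filter (almost_everywhere leb1) := ae_filter_ringOfSetsType leb1.
  apply: filterS (filterI (filterI s1 s2) (filterI tT (filterI vg1 vg2))).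
  move=> t [[i1 i2] [tT' [w1 w2]]] It.
  have t0T : 0 < t < T.
    move: It; rewrite /I/= in_itv/= => /andP[t0t tleT].
    by rewrite (lt_le_trans t00 t0t)/= lt_neqAle tT'.
  exact: weak_gradient_unique abE (w1 t0T) (w2 t0T) (i1 It) (i2 It).
have mf (g : 'rV[R]_N * R -> 'rV[R]_N) : measurable_fun (K `*` I) (Phi \o g) ->
    measurable_fun setT ((fun z : X => (Phi (g z))%:E) \_ (K `*` I)).
  by move=> mg; apply/(measurable_restrictT _ mKI); exact/measurable_EFinP.
have f0 (g : 'rV[R]_N * R -> 'rV[R]_N) z :
    (0 <= ((fun z : X => (Phi (g z))%:E) \_ (K `*` I)) z)%E.
  by apply: erestrict_ge0 => ? _; rewrite lee_fin.
rewrite [LHS]integral_mkcond [RHS]integral_mkcond.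
rewrite [LHS](integral_lebesgue_rVR (mf _ m1) (f0 _)).
rewrite [RHS](integral_lebesgue_rVR (mf _ m2) (f0 _)).
apply: ge0_ae_eq_integral => //.
- exact: measurable_integral_slice (mf _ m1) (f0 _).
- exact: measurable_integral_slice (mf _ m2) (f0 _).
- by move=> t _; exact: integral_ge0.
- by move=> t _; exact: integral_ge0.
have : {ae leb1, forall t, I t -> forall i,
    ae_eq (lebesgue_rV N) K (fun x => (g1 (x, t) ord0 i)%:E)
      (fun x => (g2 (x, t) ord0 i)%:E)}.
  have FF : Filter (almost_everywhere leb1) := ae_filter_ringOfSetsType leb1.
  have := @filter_forall _ _ _ _ FF ae_coord.
  by apply: filterS => t tE It i; exact: tE.
apply: filterS => t tE _.
apply: ge0_ae_eq_integral => //.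
- by apply: measurableT_comp (mf _ m1) _; exact: pair2_measurable.
- by apply: measurableT_comp (mf _ m2) _; exact: pair2_measurable.
have [It|nIt] := pselect (I t); last first.
  apply: aeW => x _; rewrite !patchE !ifF//; apply: memNset => -[_]; exact: nIt.
have Fx := ae_filter_ringOfSetsType (@lebesgue_rV R N).
have := @filter_forall _ _ _ _ Fx (tE It).
apply: filterS => x g12 _; rewrite !patchE.
case: ifPn => // /set_mem[Kx _].
suff -> : g1 (x, t) = g2 (x, t) by [].
by apply/rowP => i; have [] := g12 i Kx.
Qed.

End slices.

(** * Comparison of densities, and the singular set *)

Section exponents.
Context {R : realType} {N : nat}.
Local Notation X := ('rV[R]_N * measurableTypeR R)%type.
Local Notation leb := (@lebesgue_rVR R N).

(** If [s <= th] the first term dominates; otherwise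
    [s ^ p = s ^ (p - q) * s ^ q] with [p - q <= 0]. *)
Lemma powR_le_add (p q th s : R) : 0 <= p <= q -> 0 < th -> 0 <= s ->
  s `^ p <= th `^ p + th `^ (p - q) * s `^ q.
Proof.
move=> /andP[p0 pq] th0 s0; have [sth|ths] := leP s th.
  rewrite (@le_trans _ _ (th `^ p))//; first by apply: ge0_ler_powR; rewrite ?nnegrE// ltW.
  by rewrite lerDl mulr_ge0// powR_ge0.
have sgt0 : 0 < s by exact: lt_trans ths.
rewrite (@le_trans _ _ (th `^ (p - q) * s `^ q))//; last by rewrite lerDr powR_ge0.
have -> : s `^ p = s `^ (p - q) * s `^ q.
  by rewrite -powRD ?subrK// (gt_eqF sgt0) implybT.
rewrite ler_pM2r ?powR_gt0// -(opprB q p) !powRN lef_pV2 ?posrE ?powR_gt0//.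
by apply: ge0_ler_powR; rewrite ?nnegrE ?subr_ge0// ltW.
Qed.

(** [powR_le_add] with [s = r * f w], integrated over [pcylinder z r], gives
    [r^p int f^p <= th^p r^(N+2) + th^(p-q) r^q int f^q].  The left side is at
    least [e * r^(N+2)] for arbitrarily small [r], so the choice
    [th^p = e / 2] leaves a positive lower bound for the density of [f^q]. *)
Lemma upper_density_exponent (f : X -> R) (p q d : R) (z : X) (C : set X) :
  0 < p <= q -> (forall w, 0 <= f w) -> measurable_fun C f -> 0 < d ->
  (forall r, 0 < r < d -> pcylinder z r `<=` C) -> measurable C ->
  (0 < upper_density (N%:R + 2 - p) (fun w => f w `^ p)%R z)%E ->
  (0 < upper_density (N%:R + 2 - q) (fun w => f w `^ q)%R z)%E.
Proof.
move=> /andP[p0 pq] f0 mf d0 dC mC /limf_esup_at_right_gt0[e e0 eP].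
apply/limf_esup_at_right_gt0.
pose th := (e / 2) `^ p^-1.
have e20 : 0 < e / 2 by rewrite divr_gt0.
have th0 : 0 < th by exact: powR_gt0.
have thp : th `^ p = e / 2 by rewrite -powRrM mulVf ?gt_eqF// powRr1// ltW.
have thpq : 0 < th `^ (p - q) by exact: powR_gt0.
exists (e / 2 / th `^ (p - q)); first by rewrite divr_gt0.
move=> b b0; have [|r /andP[r0 +] er] := eP (Num.min b d); first by rewrite lt_min b0.
rewrite lt_min => /andP[rb rd]; exists r; first by rewrite r0.
have rC : pcylinder z r `<=` C by apply: dC; rewrite r0.
have mQ : measurable (pcylinder z r : set X) := measurable_pcylinder z r.
have mfQ : measurable_fun (pcylinder z r : set X) f by exact: measurable_funS mf.
have mfX s : measurable_fun (pcylinder z r : set X) (fun w => (f w `^ s)%:E).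
  apply/measurable_EFinP.
  by apply: (measurableT_comp (f := fun x => x `^ s) _ mfQ); exact: measurable_powR.
have J0 s : (0 <= \int[leb]_(w in pcylinder z r) (f w `^ s)%:E)%E.
  by apply: integral_ge0 => w _; rewrite lee_fin powR_ge0.
set V := r `^ (N%:R + 2); have V0 : 0 < V by exact: powR_gt0.
have rq0 : 0 < r `^ q by exact: powR_gt0.
have rp0 : 0 < r `^ p by exact: powR_gt0.
set c := th `^ (p - q) * r `^ q; have c0 : 0 < c by exact: mulr_gt0.
have lower : ((e * V)%:E <=
    (r `^ p)%:E * \int[leb]_(w in pcylinder z r) (f w `^ p)%:E)%E.
  have rk : 0 < r `^ (N%:R + 2 - p) by exact: powR_gt0.
  move: er; rewrite mul1r lee_pdivlMl// -EFinM => er.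
  have -> : e * V = r `^ p * (r `^ (N%:R + 2 - p) * e).
    rewrite mulrA -powRD; last by rewrite (gt_eqF r0) implybT.
    by rewrite addrC subrK mulrC.
  by rewrite EFinM lee_pmul2l// lte_fin.
have upper : ((r `^ p)%:E * \int[leb]_(w in pcylinder z r) (f w `^ p)%:E <=
    (e / 2 * V)%:E + c%:E * \int[leb]_(w in pcylinder z r) (f w `^ q)%:E)%E.
  have scale s k : 0 <= k -> (k%:E * \int[leb]_(w in pcylinder z r) (f w `^ s)%:E =
      \int[leb]_(w in pcylinder z r) (k%:E * (f w `^ s)%:E))%E.
    move=> k0; rewrite ge0_integralZl_EFin// => w _.
    by rewrite lee_fin powR_ge0.
  rewrite (scale _ _ (ltW rp0)) (scale _ _ (ltW c0)).
  rewrite EFinM -(lebesgue_pcylinder z r0) -(integral_cst leb mQ (e / 2)%:E).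
  rewrite -ge0_integralD//=; last 3 first.
  - by move=> w _; rewrite lee_fin ltW.
  - by move=> w _; rewrite lee_fin mulr_ge0 ?powR_ge0// ltW.
  - by apply: measurable_funeM; exact: mfX.
  apply: ge0_le_integral => //.
  - by move=> w _; rewrite lee_fin mulr_ge0 ?powR_ge0// ltW.
  - by apply: measurable_funeM; exact: mfX.
  - by apply: emeasurable_funD => //; apply: measurable_funeM; exact: mfX.
  move=> w _; rewrite -!EFinM -EFinD lee_fin -thp /c.
  have := @powR_le_add p q th (r * f w); rewrite (ltW p0) pq => /(_ isT th0).
  by rewrite !powRM ?(ltW r0)// mulrA; apply; rewrite mulr_ge0// ltW.
have := le_trans lower upper; move: (J0 q).
case: (integral _ _ _) => [j|_ _|//]; last first.
  by rewrite gt0_muley ?leey// lte_fin divr_gt0// powR_gt0.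
rewrite -!EFinM -EFinD !lee_fin => j0 ineq.
rewrite mul1r ler_pdivlMl ?powR_gt0// [r `^ (_ - q)]powRB; last by rewrite (gt_eqF r0) implybT.
rewrite -/V.
have -> : V / r `^ q * (e / 2 / th `^ (p - q)) = (e / 2 * V) / c.
  by rewrite /c; field; rewrite !gt_eqF.
rewrite ler_pdivrMr// mulrC; lra.
Qed.

Lemma upper_density_le_exponent (f : X -> R) (k l : R) (z : X) :
  k <= l -> l <= 1 -> (0 < upper_density k f z)%E -> (forall w, 0 <= f w) ->
  (0 < upper_density l f z)%E.
Proof.
move=> kl l1 /limf_esup_at_right_gt0[e e0 eP] f0.
apply/limf_esup_at_right_gt0; exists e => // d d0.
have [|r /andP[r0 +] er] := eP (Num.min d 1); first by rewrite lt_min d0 ltr01.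
rewrite lt_min => /andP[rd /ltW r1]; exists r; first by rewrite r0.
apply: (le_trans er); apply: lee_wpmul2r.
  by apply: integral_ge0 => w _; rewrite lee_fin.
rewrite lee_fin !mul1r lef_pV2 ?posrE ?powR_gt0//.
by apply: ger_powR => //; rewrite r0.
Qed.

End exponents.

Section local_integrability.
Context {R : realType} {N : nat}.
Implicit Types (E : set 'rV[R]_N) (T p h t : R) (g : 'rV[R]_N * R -> 'rV[R]_N).
Local Notation X := ('rV[R]_N * measurableTypeR R)%type.
Local Notation leb := (@lebesgue_rVR R N).

Definition lower_corner (y : 'rV[R]_N) h (i : 'I_N) : R := y ord0 i - h / 2.
Definition upper_corner (y : 'rV[R]_N) h (i : 'I_N) : R := y ord0 i + h / 2.

Lemma cube_open_box (y : 'rV[R]_N) h :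
  cube y h = open_box (lower_corner y h) (upper_corner y h).
Proof. by rewrite cubeE. Qed.

Lemma closed_box_cube (y : 'rV[R]_N) h :
  closed_box (lower_corner y h) (upper_corner y h) =
  [set x : 'rV[R]_N | forall i, `|x ord0 i - y ord0 i| <= h / 2].
Proof.
by apply/seteqP; split => x xy i; have := xy i; rewrite /= in_itv/= ler_distl.
Qed.

Lemma euclid_norm_ge0 (w : 'rV[R]_N) : 0 <= euclid_norm w.
Proof. exact: sqrtr_ge0. Qed.

Lemma Lp_loc_cube E T p g (y : 'rV[R]_N) h t : Lp_loc E T p g ->
  [set x : 'rV[R]_N | forall i, `|x ord0 i - y ord0 i| <= h / 2] `<=` E ->
  0 < t ->
  measurable_fun (cube y h `*` `[t, T] : set X) (fun z => euclid_norm (g z)) /\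
  (\int[leb]_(z in cube y h `*` `[t, T]) (euclid_norm (g z) `^ p)%:E < +oo)%E.
Proof.
move=> gp yE t0; rewrite -closed_box_cube in yE.
have cC := compact_setX (@compact_closed_box _ _ (lower_corner y h)
  (upper_corner y h)) (@segment_compact _ t T).
have [|mg goo] := gp _ cC.
  move=> z [/yE Ez]; rewrite /= !in_itv/= => /andP[tz ->].
  by split => //; rewrite /= andbT (lt_le_trans t0).
have sub : cube y h `*` `[t, T]%classic `<=`
    closed_box (lower_corner y h) (upper_corner y h) `*` `[t, T]%classic.
  by move=> z [zy zt]; split => //; apply: open_box_closed; rewrite -cube_open_box.
have mcube : measurable (cube y h `*` `[t, T] : set X).
  by apply: measurableX => //; exact: measurable_cube.
have mbox : measurable (closed_box (lower_corner y h) (upper_corner y h) `*`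
    `[t, T] : set X).
  by apply: measurableX => //; exact: measurable_closed_box.
have mn : measurable_fun (closed_box (lower_corner y h) (upper_corner y h) `*`
    `[t, T] : set X) (fun z => euclid_norm (g z)) by exact/measurable_EFinP.
split; first exact: measurable_funS mn.
apply: le_lt_trans goo.
under [leRHS]eq_integral do
  rewrite gee0_abs ?lee_fin ?euclid_norm_ge0// poweR_EFin.
apply: ge0_subset_integral => //.
  apply/measurable_EFinP.
  by apply: (measurableT_comp (f := fun x => x `^ p) _ mn); exact: measurable_powR.
by move=> z _; rewrite lee_fin powR_ge0.
Qed.

Lemma integrable_cubes_Lp_loc E T p g : Lp_loc E T p g ->
  integrable_cubes E T (fun z => euclid_norm (g z) `^ p).
Proof.
move=> gp y h t yE t0; have [mg goo] := Lp_loc_cube gp yE t0.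
split => //.
by apply: (measurableT_comp (f := fun x => x `^ p) _ mg); exact: measurable_powR.
Qed.

Lemma euclid_norm_powR2 (w : 'rV[R]_N) :
  euclid_norm w `^ 2 = \sum_(i < N) w ord0 i ^+ 2.
Proof.
rewrite powR_mulrn ?euclid_norm_ge0// sqr_sqrtr// sumr_ge0// => i _.
exact: sqr_ge0.
Qed.

(** The space [L2loc_W12loc] provides a square integrable gradient of [v], with
    which [g] agrees almost everywhere. *)
Lemma integrable_cubes_gradient2 E T (v : 'rV[R]_N * R -> \bar R) g :
  L2loc_W12loc E T v -> spatial_gradient E T v g ->
  integrable_cubes E T (fun z => euclid_norm (g z) `^ 2).
Proof.
move=> [g' [g'v _ g'2]] gv y h t yE t0; rewrite -closed_box_cube in yE.
rewrite cube_open_box; move: yE.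
set a := lower_corner y h; set b := upper_corner y h => yE.
have mK : measurable (open_box a b `*` `[t, T] : set X).
  by apply: measurableX => //; exact: measurable_open_box.
have sub : open_box a b `*` `[t, T]%classic `<=` closed_box a b `*` `[t, T]%classic.
  by move=> z [zy zt]; split => //; exact: open_box_closed.
have mbox : measurable (closed_box a b `*` `[t, T] : set X).
  by apply: measurableX => //; exact: measurable_closed_box.
have mcoord (w : 'rV[R]_N * R -> 'rV[R]_N) i : spatial_gradient E T v w ->
    measurable_fun (open_box a b `*` `[t, T] : set X) (fun z => w z ord0 i).
  move=> [_ w1 _].
  have [mw _] := w1 i _ _ _ (@compact_closed_box _ _ a b) yE t0 (lexx T).
  by apply/measurable_EFinP; exact: measurable_funS mw.
have m2 (w : 'rV[R]_N * R -> 'rV[R]_N) : spatial_gradient E T v w ->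
    measurable_fun (open_box a b `*` `[t, T] : set X)
      ((fun x => euclid_norm x `^ 2) \o w).
  move=> wv; rewrite (_ : _ \o w = fun z => \sum_(i < N) w z ord0 i ^+ 2).
    2: by apply/funext => z; exact: euclid_norm_powR2.
  apply: measurable_sum => i; apply: measurable_funX; exact: mcoord.
split; first exact: m2.
have n0 (w : 'rV[R]_N) : 0 <= euclid_norm w `^ 2 by exact: powR_ge0.
rewrite (integral_eq_spatial_gradient gv g'v yE t0 n0 (m2 _ gv) (m2 _ g'v)).
under eq_integral do rewrite /= euclid_norm_powR2 -sumEFin.
rewrite ge0_integral_sum//; last 2 first.
- by move=> i; apply/measurable_EFinP; apply: measurable_funX; exact: mcoord.
- by move=> i z _; rewrite lee_fin sqr_ge0.
apply: lte_sum_pinfty => i _.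
have [mg' goo] := g'2 i _ _ _ (@compact_closed_box _ _ a b) yE t0 (lexx T).
apply: le_lt_trans goo.
under [leRHS]eq_integral => z _ do
  rewrite /= -/(powR _ _) powR_mulrn// real_normK ?num_real//.
apply: ge0_subset_integral => //.
- by apply/measurable_EFinP/measurable_funX/measurable_EFinP.
- by move=> z _; rewrite lee_fin sqr_ge0.
Qed.

End local_integrability.

Theorem theorem1p2 (R : realType) (N : nat) (E : set 'rV[R]_N) (T p : R)
    (u : 'rV[R]_N * R -> R) (Dlnu : 'rV[R]_N * R -> 'rV[R]_N)
    (N_gt0 : (0 < N)%N) (E_open : open E) (T_gt0 : 0 < T)
    (u_sol : weak_solution E T u) (u_bnd : locally_bounded E T u)
    (Dlnu_grad : spatial_gradient E T (log_fun u) Dlnu)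
    (p_gt : (N%:R + 2) / 2 < p) (Dlnu_Lp : Lp_loc E T p Dlnu) :
  ((1 < N)%N -> p <= N%:R + 2 ->
     parabolic_hausdorff (N%:R + 2 - p) (singular_set E T p Dlnu) = 0%E) /\
  (N = 1%N -> parabolic_hausdorff 1 (singular_set E T p Dlnu) = 0%E).
Proof.
have N0 : 0 <= N%:R :> R by exact: ler0n.
have p0 : 0 < p by lra.
have intp := integrable_cubes_Lp_loc Dlnu_Lp.
have fp0 q z : 0 <= euclid_norm (Dlnu z) `^ q by exact: powR_ge0.
split=> [_ _|N1]; apply: parabolic_hausdorff_eq0 => d d0.
  apply: (parabolic_premeasure_density_eq0 E_open _ (fp0 p) intp d0).
  by rewrite gtrBl.
suff [f [f0 intf sing]] : exists f : 'rV[R]_N * R -> R, [/\ forall z, 0 <= f z,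
    integrable_cubes E T f & singular_set E T p Dlnu `<=`
      [set z | (E `*` `]0, T]) z /\ (0 < upper_density 1 f z)%E]].
  apply/eqP; rewrite eq_le parabolic_premeasure_ge0 andbT.
  have k1 : 1 < N%:R + 2 :> R by lra.
  rewrite -[leRHS](parabolic_premeasure_density_eq0 E_open k1 f0 intf d0).
  exact: parabolic_premeasureS.
have [p2|p2] := leP 2 p.
  exists (fun z => euclid_norm (Dlnu z) `^ p); split; [exact: fp0|exact: intp|].
  move=> z [Ez sz]; split; first exact: Ez.
  apply: upper_density_le_exponent sz (fp0 p); last exact: lexx.
  by rewrite N1; lra.
exists (fun z => euclid_norm (Dlnu z) `^ 2); split; first exact: fp0.
  by apply: integrable_cubes_gradient2 Dlnu_grad; have [[[]]] := u_sol.
move=> z [[Ez tz] sz]; split; first by split.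
have k1 : 1 = N%:R + 2 - 2 :> R by rewrite N1 addrK.
have density2 k : k = N%:R + 2 - 2 ->
    (0 < upper_density k (fun w => euclid_norm (Dlnu w) `^ 2)%R z)%E; last first.
  exact: density2 k1.
move=> {k}-> {k1}.
move: tz; rewrite /= in_itv/= => /andP[z0 zT].
have /nbhs_ballP[r /= r0 rE] : nbhs z.1 E by exact: open_nbhs_nbhs.
have [||mC _] := Lp_loc_cube (y := z.1) (h := r) (t := z.2 / 2) Dlnu_Lp.
- move=> x xz; apply: rE; split => // i j; rewrite ord1 /ball/= distrC.
  by apply: (le_lt_trans (xz j)); rewrite ltr_pdivrMr//; lra.
- by rewrite divr_gt0.
apply: (upper_density_exponent (p := p) (d := Num.min r (Num.min 1 (z.2 / 2)))
  (C := cube z.1 r `*` `[z.2 / 2, T])).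
- by rewrite p0 ltW.
- by move=> w; exact: euclid_norm_ge0.
- exact: mC.
- by rewrite !lt_min r0 ltr01 divr_gt0.
- move=> s /andP[s0]; rewrite !lt_min => /and3P[sr s1 sz2] x [/= xz1].
  rewrite in_itv/= => /andP[xz2 xz3]; split => /= [i|].
    by apply: (lt_trans (xz1 i)); rewrite ltr_pM2r.
  by rewrite in_itv/= (le_trans xz3 zT) andbT; nra.
- by apply: measurableX => //; exact: measurable_cube.
- exact: sz.
Qed.
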